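(* Let $N\ge 2$, $n\ge 1$, $\tau\ge 1$, $K\ge 1$ be integers, let $f_1,\dots,f_N:\mathbb{R}^n\to\mathbb{R}$ be differentiable functions and $f=\frac1N\sum_{i=1}^N f_i$. Assume: (i) there is $L>0$ with $\|\nabla f_i(x)-\nabla f_i(y)\|\le L\|x-y\|$ for all $x,y\in\mathbb{R}^n$ and all $i$; (ii) $f$ attains its minimum over $\mathbb{R}^n$, and $x^*$ is a minimizer; (iii) the mixing matrix $W\in\mathbb{R}^{N\times N}$ of a connected undirected graph satisfies the mixing conditions stated in the context. Let $\xi\in(0,\frac{2}{\tau+3})$, let $x_i(t)$ be generated by the algorithm MILE (defined in the context) with stepsize $\alpha$, and let $\rho$ and $B_2$ be the constants defined in the context. If $0<\alpha\le\frac{1}{\sqrt{5B_2}\,L}$, then, with $T=\tau+\tau K$, $$\frac{1}{T}\sum_{t=1}^{T}\|\nabla f(\overline{X}(t))\|^2\le \frac{2}{\tau\alpha K}\bigl\{f(\overline{X}(1))-f(x^* )\bigr\}+\frac{\|\overline{\nabla f}(X(0))\|^2}{\tau^3K}+\frac{4\|X(0)\|_F^2+4\|X(1)\|_F^2}{\tau^3\alpha^2K}+\frac{2\|X(0)\|_F^2+2\|X(1)\|_F^2}{\alpha^2\rho^2\tau^4K}.$$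
   Context: Network and mixing matrix. $\mathcal{G}=(\mathcal{V},\mathcal{E})$ is a connected undirected graph on $\mathcal{V}=\{1,\dots,N\}$. The matrix $W=(w_{ij})\in\mathbb{R}^{N\times N}$ satisfies: (1) $w_{ij}=0$ if $i\ne j$ and $(i,j)\notin\mathcal{E}$; (2) $W=W^{\top}$; (3) $\mathrm{Null}(\mathbf{I}_N-W)=\mathrm{span}(\mathbf{1}_N)$; (4) $2\mathbf{I}_N\succeq W+\mathbf{I}_N\succ 0$. Its eigenvalues then satisfy $1=\lambda_1>\lambda_2\ge\dots\ge\lambda_N>-1$. Algorithm MILE. Parameters: number of local updates $\tau\in\{1,2,\dots\}$, stepsize $\alpha>0$, weight $\xi\in(0,\frac{2}{\tau+3})$. Put $\widetilde w_{ii}=(1-\xi)+\xi w_{ii}$ and $\widetilde w_{ij}=\xi w_{ij}$ for $j\ne i$. The values $x_i(-1)\in\mathbb{R}^n$ are arbitrary and $x_i(0)=x_i(-1)-\alpha\nabla f_i(x_i(-1))$. For $t=0,1,2,\dots$ and each $i$: if $t \bmod \tau=0$, $$x_i(t+1)=\sum_{j=1}^N\widetilde w_{ij}\bigl\{2x_j(t)-x_j(t-1)-\alpha\nabla f_j(x_j(t))+\alpha\nabla f_j(x_j(t-1))\bigr\};$$ otherwise $$x_i(t+1)=2x_i(t)-x_i(t-1)-\alpha\nabla f_i(x_i(t))+\alpha\nabla f_i(x_i(t-1)).$$ Notation. $X(t)=[x_1(t),\dots,x_N(t)]\in\mathbb{R}^{n\times N}$, $\overline X(t)=\frac1N\sum_{i=1}^N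 x_i(t)$, $\overline{\nabla f}(X(t))=\frac1N\sum_{i=1}^N\nabla f_i(x_i(t))$; $\|\cdot\|$ is the Euclidean norm and $\|\cdot\|_F$ the Frobenius norm. Constants. $\rho_i=1-\xi+\xi\lambda_i$, $\rho=\rho_2=1-\xi+\xi\lambda_2$, $$A_1=\max_{2\le i\le N}\frac{2\tau}{\sqrt{4\rho_i-[\rho_i(\tau+1)+1-\tau]^2}},$$ $$A_3=\max\left\{\frac{2\sqrt\rho+2}{\sqrt{4\rho-[\rho(\tau+1)+(1-\tau)]^2}},\ \frac{2\sqrt\rho\,\bigl(1+|\tau\sqrt\rho-\frac{\tau-1}{\sqrt\rho}|\bigr)}{\sqrt{4\rho-[\rho(\tau+1)+(1-\tau)]^2}}\right\},$$ $A_4=\max\{A_1,A_3\}$, and $$B_2=3\tau^4+\frac{\tau^2(\tau+1)(2\tau+1)(\rho\tau+\tau-1)^2}{2(1-\sqrt\rho)^2}A_4^2.$$ *)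

(* Defs.v *)
From HB Require Import structures.
From mathcomp Require Import all_boot all_order all_algebra.
From mathcomp Require Import all_classical all_reals all_analysis.

Set Implicit Arguments.
Unset Strict Implicit.
Unset Printing Implicit Defensive.

Import Order.TTheory GRing.Theory Num.Theory.
Import numFieldNormedType.Exports.

Local Open Scope ring_scope.

(* The norm `|A| that the library puts on matrices is the sup norm.  fnorm is
   the Frobenius norm, which on column vectors is the Euclidean norm. *)
Definition fnorm (R : realType) (m n : nat) (A : 'M[R]_(m, n)) : R :=
  Num.sqrt (\sum_(i < m) \sum_(j < n) A i j ^+ 2).

Definition grad (R : realType) (n : nat) (f : 'cV[R]_n -> R) (x : 'cV[R]_n) :
    'cV[R]_n :=
  \col_(k < n) 'D_(delta_mx k 0) f x.

Definition posdefmx (R : realType) (N : nat) (A : 'M[R]_N) : Prop :=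
  A^T = A /\ forall v : 'cV[R]_N, v != 0 -> 0 < (v^T *m A *m v) 0 0.

Definition possemidefmx (R : realType) (N : nat) (A : 'M[R]_N) : Prop :=
  A^T = A /\ forall v : 'cV[R]_N, 0 <= (v^T *m A *m v) 0 0.

(* e i j means that {i, j} is an edge; self-loops are irrelevant below. *)
Definition connected_graph (N : nat) (e : rel 'I_N) : Prop :=
  symmetric e /\ forall i j : 'I_N, connect e i j.

Definition mixing_matrix (R : realType) (N : nat) (e : rel 'I_N)
    (W : 'M[R]_N) : Prop :=
  [/\ forall i j, i != j -> ~~ e i j -> W i j = 0,
      W^T = W,
      forall v : 'cV[R]_N,
        (1%:M - W) *m v = 0 <-> exists c : R, v = c *: const_mx 1
    & possemidefmx (2%:M - (W + 1%:M)) /\ posdefmx (W + 1%:M)].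

(* lam lists the eigenvalues of W with multiplicity in nonincreasing order;
   such a list is unique, and it exists when W is symmetric. *)
Definition eigenvalue_list (R : realType) (N : nat) (W : 'M[R]_N)
    (lam : seq R) : Prop :=
  sorted (fun x y : R => y <= x) lam /\
  char_poly W = \prod_(l <- lam) ('X - l%:P).

Section Constants.
Context {R : realType}.
Variables (N tau : nat) (xi : R) (lam : seq R).
Local Notation t_ := (tau%:R : R).

(* lambda_i with 1-based index i *)
Definition eig (i : nat) : R := lam`_i.-1.

Definition rho_ (i : nat) : R := 1 - xi + xi * eig i.

Definition rho : R := rho_ 2.

(* The terms are nonnegative, so the neutral element 0 does not affect the
   maximum once 2 <= N. *)
Definition A1 : R :=
  \big[Num.max/0]_(2 <= i < N.+1)
    (2 * t_ / Num.sqrt (4 * rho_ i - (rho_ i * (t_ + 1) + 1 - t_) ^+ 2)).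

Definition A3 : R :=
  Num.max
    ((2 * Num.sqrt rho + 2)
      / Num.sqrt (4 * rho - (rho * (t_ + 1) + (1 - t_)) ^+ 2))
    (2 * Num.sqrt rho
        * (1 + `|t_ * Num.sqrt rho - (t_ - 1) / Num.sqrt rho|)
      / Num.sqrt (4 * rho - (rho * (t_ + 1) + (1 - t_)) ^+ 2)).

Definition A4 : R := Num.max A1 A3.

Definition B2 : R :=
  3 * t_ ^+ 4
  + t_ ^+ 2 * (t_ + 1) * (2 * t_ + 1) * (rho * t_ + t_ - 1) ^+ 2
    / (2 * (1 - Num.sqrt rho) ^+ 2) * A4 ^+ 2.

End Constants.

Section Algorithm.
Context {R : realType} {N n : nat}.

(* An agent profile z : 'I_N -> 'cV[R]_n holds one vector per agent. *)
Definition stack (z : 'I_N -> 'cV[R]_n) : 'M[R]_(n, N) :=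
  \matrix_(k < n, i < N) z i k 0.

Definition avg (z : 'I_N -> 'cV[R]_n) : 'cV[R]_n :=
  N%:R^-1 *: \sum_(i < N) z i.

Definition favg (f : 'I_N -> 'cV[R]_n -> R) (x : 'cV[R]_n) : R :=
  N%:R^-1 * \sum_(i < N) f i x.

Definition lazy_mx (xi : R) (W : 'M[R]_N) : 'M[R]_N :=
  \matrix_(i, j) (if i == j then (1 - xi) + xi * W i i else xi * W i j).

Definition local_step (f : 'I_N -> 'cV[R]_n -> R) (alpha : R)
    (x : int -> 'I_N -> 'cV[R]_n) (t : int) (i : 'I_N) : 'cV[R]_n :=
  2 *: x t i - x (t - 1) i
  - alpha *: grad (f i) (x t i) + alpha *: grad (f i) (x (t - 1) i).

(* Time is int-valued because the recursion starts from the free initial value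
   x (-1); values at times below -1 play no role. *)
Definition MILE (tau : nat) (xi alpha : R) (W : 'M[R]_N)
    (f : 'I_N -> 'cV[R]_n -> R) (x : int -> 'I_N -> 'cV[R]_n) : Prop :=
  (forall i, x 0 i = x (- 1) i - alpha *: grad (f i) (x (- 1) i)) /\
  (forall (t : nat) (i : 'I_N),
     x (t%:Z + 1) i =
       if (t %% tau == 0)%N
       then \sum_(j < N) lazy_mx xi W i j *: local_step f alpha x t%:Z j
       else local_step f alpha x t%:Z i).

End Algorithm.

(* Main.v *)
Require Import Defs.
From HB Require Import structures.
From mathcomp Require Import all_boot all_order all_algebra.
From mathcomp Require Import all_classical all_reals all_analysis.
From mathcomp Require Import unstable ring lra zify.
Import Order.TTheory GRing.Theory Num.Theory.
Import numFieldNormedType.Exports.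
Local Open Scope ring_scope.

Set Implicit Arguments.
Unset Strict Implicit.
Unset Printing Implicit Defensive.

(** The idea. Write D t = x (t + 1) - x t + alpha grad f (x t). During the local
    updates D does not change, and its average over the agents is always zero, so
    the mean iterate performs gradient descent with the averaged local gradients
    (mean_step). The descent lemma then bounds the sum of
    |grad f (mean)|^2 by f (mean 1) - f xstar, a negative multiple of the sum of
    the squared mean gradients, and L^2 / N times the summed consensus error
    (gradient_step_descent). It remains to bound the consensus error by the
    initial data and a small multiple of the mean gradients.

    In an orthonormal eigenbasis of W (symmetric_diagonalization,
    mixing_spectrum) the deviation from the mean splits into scalar modes, each
    obeying the recursion mode_recursion with its own factor rho in (0, 1)
    (MILE_modal). Over one period, a mode with state (x, slope) undergoes a
    2 x 2 linear map of determinant rho, forced only by the drift of the gradient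
    within the period. The condition on xi makes the eigenvalues of this map
    non-real (mode_disc_gt0), hence of modulus sqrt rho, and the map multiplies
    the definite quadratic form v |-> det (v, M v) by exactly rho
    (mode_form_step). Using this form as a Lyapunov function, the total energy
    of a mode is bounded by its initial energy and by the squared drifts with a
    factor of order 1 / (1 - sqrt rho)^2 (mode_energy). The largest ratio
    between squared positions and the form is governed by mode_disc, and this is
    what the constant A1 records (A1_bound).

    By the Lipschitz condition the drifts are themselves bounded by alpha^2 L^2
    times the consensus error and the displacement of the mean, so summing over
    the modes gives a self-bounding estimate (consensus_energy). B2 dominates
    three times its constant, the step-size restriction makes the coefficient of
    the consensus error on the right at most 4 / 15, and the estimate can be
    solved (consensus_arith). Inserting it into the summed descent inequality
    gives the rate (rate_arith). *)

(** * Elementary inequalities *)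

(** Cauchy-Schwarz for n + 1 summands, one of which is kept apart: b is the sum
    of the other n and S bounds the sum of their squares. *)
Lemma sqr_add_le (R : realFieldType) (n a b S : R) :
  0 <= n -> 0 <= S -> b ^+ 2 <= n * S -> (a + b) ^+ 2 <= (n + 1) * (a ^+ 2 + S).
Proof.
rewrite le_eqVlt => /predU1P[<- S0|n0 S0 bS].
  rewrite mul0r => b0; have -> : b = 0 by apply/eqP; rewrite -sqrf_eq0; nra.
  by rewrite addr0 add0r mul1r lerDl.
rewrite -subr_ge0 -(pmulr_rge0 _ n0).
have := sqr_ge0 (n * a - b); nra.
Qed.

Lemma sqr_sum_le (R : realFieldType) (I : Type) (s : seq I) (a : I -> R) :
  (\sum_(i <- s) a i) ^+ 2 <= (size s)%:R * \sum_(i <- s) a i ^+ 2.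
Proof.
elim: s => [|i s IH]; first by rewrite !big_nil mulr0 expr0n.
rewrite !big_cons /= -natr1; apply: sqr_add_le => //.
by apply: sumr_ge0 => j _; apply: sqr_ge0.
Qed.

(** Summing the recursion over k leaves r times the same sum, short of its last
    term, on the right. *)
Lemma geometric_sum_le (R : realFieldType) (r c : R) (a b : nat -> R) K :
  0 <= r -> (forall k, 0 <= a k) ->
  a 0 <= c + b 0 -> (forall k, (k < K)%N -> a k.+1 <= r * a k + b k.+1) ->
  (1 - r) * \sum_(0 <= k < K.+1) a k <= c + \sum_(0 <= k < K.+1) b k.
Proof.
move=> r0 a0 ac ab.
suff: \sum_(0 <= k < K.+1) a k - r * \sum_(0 <= k < K) a k
    <= c + \sum_(0 <= k < K.+1) b k.
  rewrite [in (1 - r) * _]big_nat_recr //= [X in X - _]big_nat_recr //=.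
  have := mulr_ge0 r0 (a0 K); lra.
elim: K ab => [|K IH] ab; first by rewrite !big_nat1 big_geq // mulr0 subr0.
rewrite big_nat_recr //= [X in r * X]big_nat_recr //= [X in _ <= c + X]big_nat_recr //=.
have := ab K (ltnSn K); have := IH (fun k h => ab k (ltnW h)); lra.
Qed.

(** * Orthogonal diagonalization of symmetric matrices *)

Lemma rowdotE (R : rcfType) n (u : 'rV[R]_n) :
  u *m u^T = (\sum_j u 0 j ^+ 2)%:M.
Proof.
rewrite [LHS]mx11_scalar mxE; congr (_ %:M).
by apply: eq_bigr => j _; rewrite mxE expr2.
Qed.

Lemma rowdot_eq0 (R : rcfType) n (u : 'rV[R]_n) :
  (\sum_j u 0 j ^+ 2 == 0) = (u == 0).
Proof.
apply/eqP/eqP => [/psumr_eq0P H|->]; last first.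
  by rewrite big1 // => j _; rewrite mxE expr0n.
apply/rowP => j; rewrite mxE; apply/eqP; rewrite -sqrf_eq0.
by apply/eqP/H => // k _; apply: sqr_ge0.
Qed.

(** The reflection in the hyperplane orthogonal to e - u, where e is the first
    unit vector; if u = e it degenerates to the identity. *)
Lemma householder (R : rcfType) n (u : 'rV[R]_n.+1) : u *m u^T = 1%:M ->
  exists H : 'M[R]_n.+1,
    [/\ H^T = H, H *m H = 1%:M & delta_mx 0 0 *m H = u].
Proof.
move=> uu; set e : 'rV[R]_n.+1 := delta_mx 0 0.
have ee : e *m e^T = 1%:M.
  by rewrite /e trmx_delta mul_delta_mx; apply/matrixP=> i j; rewrite !ord1 !mxE.
have [-> | neq_ue] := eqVneq u e.
  by exists 1%:M; rewrite trmx1 !mulmx1.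
have [w wE] : exists w, w = e - u by exists (e - u).
set s := \sum_j w 0 j ^+ 2.
have s0 : s != 0 by rewrite rowdot_eq0 wE subr_eq0 eq_sym.
have ww : w *m w^T = s%:M by rewrite rowdotE.
have eu : u *m e^T = e *m u^T.
  by rewrite -[LHS]trmxK trmx_mul trmxK [LHS]mx11_scalar mxE -mx11_scalar.
(* <e, e - u> is half of |e - u|^2 because e and u have the same norm *)
have ew : 2 *: (e *m w^T) = s%:M.
  rewrite -ww wE linearB /= mulmxBr [RHS]mulmxBl !mulmxBr ee uu eu.
  by rewrite opprB scaler_nat mulr2n.
exists (1%:M - (2 / s) *: (w^T *m w)); split.
- by rewrite linearB linearZ /= trmx1 trmx_mul trmxK.
- rewrite mulmxBl mul1mx mulmxBr mulmx1 -scalemxAl -scalemxAr.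
  rewrite -mulmxA [w *m _]mulmxA ww mul_scalar_mx -scalemxAr !scalerA.
  rewrite -{1}[1%:M]addr0 -[RHS]addr0 -!addrA; congr (_ + _).
  rewrite add0r -scaleNr -scalerBl -scalerBl; apply/eqP; rewrite scaler_eq0.
  by apply/orP; left; apply/eqP; field.
- rewrite mulmxBr mulmx1 -scalemxAr mulmxA [2 / s]mulrC -scalerA scalemxAl ew.
  by rewrite mul_scalar_mx scalerA mulVf // scale1r wE subKr.
Qed.

Lemma char_poly_conj (R : comNzRingType) n (H A : 'M[R]_n) : H *m H = 1%:M ->
  char_poly (H *m A *m H) = char_poly A.
Proof.
move=> HH; rewrite /char_poly.
have HH' : map_mx polyC H *m map_mx polyC H = 1%:M.
  by rewrite -map_mxM HH map_mx1.
have -> : char_poly_mx (H *m A *m H) =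
    map_mx polyC H *m char_poly_mx A *m map_mx polyC H.
  rewrite /char_poly_mx !map_mxM mulmxBr mulmxBl; congr (_ - _).
  by rewrite mul_mx_scalar -scalemxAl HH' scalemx1.
rewrite !det_mulmx mulrAC -det_mulmx HH' det1 mul1r //.
Qed.

(** Deflation. The head of the list is an eigenvalue; a Householder reflection
    moves a unit eigenvector to the first axis, and symmetry then clears the
    first row and column. The characteristic polynomial of the remaining block
    is the product over the tail of the list, so the induction proceeds inside
    the real field and the diagonal keeps the order of the list. *)
Theorem symmetric_diagonalization (R : rcfType) (lam : seq R) n (W : 'M[R]_n) :
  W^T = W -> char_poly W = \prod_(l <- lam) ('X - l%:P) ->
  exists P : 'M[R]_n,
    P *m P^T = 1%:M /\ W = P^T *m diag_mx (\row_i lam`_i) *m P.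
Proof.
elim: lam n W => [|l lam IH] [|n] W symW charW.
- by exists 1%:M; split; apply/matrixP => -[].
- by have := size_char_poly W; rewrite charW big_nil size_poly1.
- by exists 1%:M; split; apply/matrixP => -[].
have [v Wv v0] : exists2 v : 'rV_n.+1, v *m W = l *: v & v != 0.
  apply/eigenvalueP; rewrite eigenvalue_root_char charW root_prod_XsubC.
  by rewrite mem_head.
pose u := (Num.sqrt (\sum_j v 0 j ^+ 2))^-1 *: v.
have vpos : 0 < \sum_j v 0 j ^+ 2.
  rewrite lt_neqAle eq_sym rowdot_eq0 v0.
  by apply: sumr_ge0 => j _; apply: sqr_ge0.
have uu : u *m u^T = 1%:M.
  rewrite linearZ /= -scalemxAl -scalemxAr rowdotE scalerA scale_scalar_mx.
  have q0 : Num.sqrt (\sum_j v 0 j ^+ 2) != 0 by rewrite lt0r_neq0 // sqrtr_gt0.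
  congr (_%:M); rewrite -[X in _ * X](sqr_sqrtr (ltW vpos)).
  by field.
have Wu : u *m W = l *: u.
  by rewrite -scalemxAl Wv !scalerA mulrC.
have [H [symH HH eH]] : exists H : 'M[R]_(1 + n),
    [/\ H^T = H, H *m H = 1%:M & delta_mx 0 0 *m H = u] by exact: householder.
have [A AE] : exists A : 'M[R]_(1 + n), A = H *m W *m H by exists (H *m W *m H).
have symA : A^T = A by rewrite AE !trmx_mul symH symW mulmxA.
have A0 : delta_mx 0 0 *m A = l *: (delta_mx 0 0 : 'rV_(1 + n)).
  rewrite AE !mulmxA eH Wu -scalemxAl -eH -mulmxA HH mulmx1 //.
have Ablock : A = block_mx l%:M 0 0 (drsubmx A).
  have A0j j : A 0 j = l * (j == 0)%:R.
    move/rowP/(_ j): A0; rewrite -rowE !mxE /= => ->; congr (_ * _).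
  have Ai0 i : A i 0 = l * (i == 0)%:R by rewrite -symA mxE A0j.
  rewrite -[LHS]submxK; congr block_mx; apply/matrixP => i j; rewrite !mxE ?ord1 /=.
  + have -> : lshift n (0 : 'I_1) = 0 by apply/val_inj.
    by rewrite A0j eqxx mulr1 mulr1n.
  + have -> : lshift n (0 : 'I_1) = 0 by apply/val_inj.
    by rewrite A0j mulr0.
  + have -> : lshift n (0 : 'I_1) = 0 by apply/val_inj.
    by rewrite Ai0 mulr0.
set B := drsubmx A in Ablock.
have symB : B^T = B by rewrite /B [LHS]trmx_drsub symA.
have charB : char_poly B = \prod_(x <- lam) ('X - x%:P).
  apply: (@mulfI _ ('X - l%:P)); first by rewrite polyXsubC_eq0.
  transitivity (char_poly W); last by rewrite charW big_cons.
  rewrite -(@char_poly_conj _ _ H W HH) -AE Ablock.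
  rewrite [RHS](congr1 determinant (@char_block_diag_mx _ 1 n l%:M B)).
  rewrite [RHS](@det_ublock _ 1 n); congr (_ * _).
  by rewrite /char_poly_mx map_scalar_mx -raddfB /= det_scalar1.
have [P' [PP' BE]] := IH _ _ symB charB.
have [Q QE] : exists Q : 'M[R]_(1 + n), Q = block_mx 1%:M 0 0 P'.
  by exists (block_mx 1%:M 0 0 P').
have trQ : Q^T = block_mx 1%:M 0 0 P'^T by rewrite QE tr_block_mx !trmx0 trmx1.
have QQ : Q *m Q^T = 1%:M.
  rewrite trQ QE mulmx_block !mulmx0 !mul0mx !mulmx1 !addr0 !add0r PP'.
  by rewrite -scalar_mx_block.
exists (Q *m H); split.
  rewrite trmx_mul symH mulmxA -[_ *m H *m H]mulmxA HH mulmx1.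
  exact: QQ.
have AQ : A = Q^T *m diag_mx (row_mx (l%:M : 'rV_1) (\row_(i < n) lam`_i)) *m Q.
  rewrite trQ QE Ablock BE diag_mx_row mulmx_block mulmx_block.
  rewrite !mulmx0 !mul0mx !mul1mx !mulmx1 !addr0 !add0r mul0mx.
  by congr block_mx; apply/matrixP => i j; rewrite !ord1 !mxE.
have WE : W = H *m A *m H by rewrite AE !mulmxA HH mul1mx -mulmxA HH mulmx1.
rewrite [LHS]WE trmx_mul symH !mulmxA; congr (_ *m H); rewrite -!mulmxA; congr (H *m _).
have -> : \row_(i < 1 + n) (l :: lam)`_i =
    row_mx (l%:M : 'rV_1) (\row_(i < n) lam`_i).
  apply/rowP => i; rewrite !mxE.
  by case: splitP => j ->; rewrite !mxE ?ord1.
by rewrite mulmxA -AQ.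
Qed.

(** * The invariant quadratic form of one mode *)

Section ModeForm.
Variables (R : realFieldType) (t rho : R).

(** Over one period without gradient drift a mode evolves by the linear map M of
    mode_form_step, whose determinant is rho and whose trace is
    rho * (t + 1) + 1 - t. This is 4 det M - (tr M)^2: when it is positive, the
    eigenvalues of M are not real and have modulus sqrt rho. *)
Definition mode_disc := 4 * rho - (rho * (t + 1) + 1 - t) ^+ 2.
(** For a 2 x 2 matrix M the quadratic form v |-> det (v, M v) is multiplied by
    det M when v is replaced by M v. Up to sign this is that form for the
    one-period map; its determinant is a quarter of mode_disc, so for rho < 1 it
    is positive definite exactly when mode_disc is positive, and then it serves
    as a Lyapunov function with the sharp contraction factor. *)
Definition mode_form (x d : R) :=
  (1 - rho) * x ^+ 2 - (t - 1) * (1 - rho) * x * d + t * rho * d ^+ 2.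

Lemma mode_form_step x d :
  mode_form ((1 - t * (1 - rho)) * x + t * rho * d) (rho * d - (1 - rho) * x)
  = rho * mode_form x d.
Proof. rewrite /mode_form; ring. Qed.

Lemma mode_form_ge0 x d : rho < 1 -> 0 < mode_disc -> 0 <= mode_form x d.
Proof.
move=> rho1 disc0; have h : 0 < 4 * (1 - rho) by lra.
rewrite -(pmulr_rge0 _ h).
have -> : 4 * (1 - rho) * mode_form x d =
  (2 * (1 - rho) * x - (t - 1) * (1 - rho) * d) ^+ 2 + mode_disc * d ^+ 2.
  by rewrite /mode_form /mode_disc; ring.
by rewrite addr_ge0 ?sqr_ge0 // mulr_ge0 ?sqr_ge0 // ltW.
Qed.

(** Convexity of a nonnegative quadratic form: the defect is the form evaluated
    at (1 - r) (a, a') - r (b, b'). *)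
Lemma mode_form_convex r a a' b b' :
  rho < 1 -> 0 < mode_disc -> 0 < r < 1 ->
  mode_form (a + b) (a' + b') <= mode_form a a' / r + mode_form b b' / (1 - r).
Proof.
move=> rho1 disc0 /andP[r0 r1].
have r0' : r != 0 by lra.
have r1' : 1 - r != 0 by lra.
rewrite -subr_ge0.
have -> : mode_form a a' / r + mode_form b b' / (1 - r)
    - mode_form (a + b) (a' + b')
  = mode_form ((1 - r) * a - r * b) ((1 - r) * a' - r * b') / (r * (1 - r)).
  by rewrite /mode_form; field; rewrite r0' r1'.
by rewrite divr_ge0 ?mode_form_ge0 // mulr_ge0; lra.
Qed.

(** The sharp constant is 4 (t rho - u (t - 1) (1 - rho) + u^2 (1 - rho)), which
    for u in [0, t - 1] is at most its value at u = 0. *)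
Lemma mode_form_coord u x d : rho < 1 -> 0 < mode_disc -> 0 <= u <= t - 1 ->
  mode_disc * (x - u * d) ^+ 2 <= 4 * t * rho * mode_form x d.
Proof.
move=> rho1 disc0 /andP[u0 u1].
have H : 0 <= 4 * (u * (t - 1) - u ^+ 2) * (1 - rho) * mode_form x d.
  rewrite !mulr_ge0 ?mode_form_ge0 //; last by lra.
  by have := mulr_ge0 u0 (_ : 0 <= t - 1 - u); rewrite subr_ge0 => /(_ u1); nra.
rewrite -subr_ge0.
have -> : 4 * t * rho * mode_form x d - mode_disc * (x - u * d) ^+ 2 =
  ((2 * (1 - rho) * u - (t - 1) * (1 - rho)) * x
   + (2 * t * rho - u * (t - 1) * (1 - rho)) * d) ^+ 2
  + 4 * (u * (t - 1) - u ^+ 2) * (1 - rho) * mode_form x d.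
  by rewrite /mode_form /mode_disc; ring.
by rewrite addr_ge0 ?sqr_ge0.
Qed.

(** The form is t rho^2 h^2 at (t rho h, rho h) and (1 - rho) Y^2 at (Y, 0). In
    the intended use Y is a sum of t - 1 terms with S the sum of their squares,
    so this is convexity for t summands; for t = 1 there is no Y, which is why
    the factor is t and not 2 t. *)
Lemma mode_form_forcing h Y S : 1 <= t -> 0 < rho < 1 -> 0 < mode_disc ->
  0 <= S -> Y ^+ 2 <= (t - 1) * S ->
  mode_form (t * rho * h + Y) (rho * h)
    <= t * (t * rho ^+ 2 * h ^+ 2 + (1 - rho) * S).
Proof.
move=> t1 /andP[rho0 rho1] disc0 S0 YS.
have -> : mode_form (t * rho * h + Y) (rho * h) =
  t * rho ^+ 2 * h ^+ 2 + (1 - rho) * ((t + 1) * rho * h * Y + Y ^+ 2).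
  by rewrite /mode_form; ring.
move: t1; rewrite le_eqVlt => /predU1P[tE|t1].
  have -> : Y = 0 by apply/eqP; rewrite -sqrf_eq0; rewrite -tE in YS; nra.
  rewrite -tE mulr0 expr0n addr0 mulr0 addr0 !mul1r lerDl mulr_ge0 //; lra.
have t0 : 0 < t - 1 by lra.
have f1 : 0 <= (1 - rho) * ((t - 1) * S - Y ^+ 2) by rewrite mulr_ge0; lra.
have f2 : 0 <= mode_disc * Y ^+ 2 by rewrite mulr_ge0 ?sqr_ge0 // ltW.
have f3 := sqr_ge0 (2 * (t - 1) * t * rho * h - (1 - rho) * (t + 1) * Y).
have t4 : 0 < 4 * t * (t - 1) by rewrite !mulr_gt0 //; lra.
rewrite -subr_ge0 -(pmulr_rge0 _ t4).
set lhs := (X in 0 <= X).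
have -> : lhs = 4 * t ^+ 2 * ((1 - rho) * ((t - 1) * S - Y ^+ 2))
  + (2 * (t - 1) * t * rho * h - (1 - rho) * (t + 1) * Y) ^+ 2
  + mode_disc * Y ^+ 2 by rewrite /lhs /mode_disc; ring.
by rewrite !addr_ge0 // mulr_ge0 // mulr_ge0 ?sqr_ge0.
Qed.
End ModeForm.

Section ModeRecursion.
Variables (R : realFieldType) (tau : nat) (rho alpha : R) (x g : nat -> R).
Local Notation t := (tau%:R : R).

Definition drift (k s : nat) : R := alpha * (g (k * tau + s) - g (k * tau)).
(** The pair (x ((k + 1) tau), slope k) is the state of the mode at the end of
    period k. As x s.+1 - x s + alpha g s is constant during a period, slope is
    that constant minus alpha g (k tau); by this shift a constant gradient drops
    out and only drifts force the recursion. *)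
Definition slope (k : nat) : R := x (k * tau).+1 - x (k * tau).

(** One coordinate of the algorithm in an orthonormal eigenbasis of the mixing
    matrix, with rho the eigenvalue of the lazy matrix. The iterate at time -1 is
    eliminated: x 0 = x (-1) - alpha g (-1) turns the first step into a
    gradient step followed by mixing. *)
Definition mode_recursion : Prop :=
  x 1 = rho * (x 0 - alpha * g 0) /\
  forall s, x s.+2 = (if (s.+1 %% tau == 0)%N then rho else 1)
    * (2 * x s.+1 - x s - alpha * g s.+1 + alpha * g s).

Hypotheses (tau1 : (1 <= tau)%N) (rec : mode_recursion).

Lemma local_increment k s : (s < tau)%N ->
  x (k * tau + s).+1 - x (k * tau + s) = slope k - drift k s.
Proof.
elim: s => [_|s IH sT]; first by rewrite addn0 /slope /drift addn0 subrr mulr0 subr0.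
case: rec => _ /(_ (k * tau + s)%N).
have -> : ((k * tau + s).+1 %% tau == 0)%N = false.
  by rewrite -addnS modnMDl modn_small.
rewrite mul1r addnS => ->; have := IH (ltnW sT).
rewrite /drift addnS; lra.
Qed.

(** Positions are measured from the end of the period: for s >= 1 the
    coefficient tau - s then lies in [0, tau - 1], the range in which
    mode_form_coord applies to the state at the end of the period. *)
Lemma period_backward k s : (s <= tau)%N ->
  x (k * tau + s) = x (k * tau + tau) - (t - s%:R) * slope k
    + \sum_(s <= r < tau) drift k r.
Proof.
move=> sT; have [m mE] : exists m, m = (tau - s)%N by exists (tau - s)%N.
elim: m s sT mE => [|m IH] s sT mE.
  have -> : s = tau by lia.
  by rewrite big_geq // subrr mul0r subr0 addr0.
have sT' : (s < tau)%N by lia.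
have := IH s.+1 sT' (_ : m = tau - s.+1)%N.
rewrite addnS -natr1 => /(_ ltac:(lia)) IHs.
have H := local_increment k sT'; rewrite IHs in H; rewrite big_ltn //; lra.
Qed.

Lemma slopeS k : slope k.+1 =
  rho * (slope k - drift k tau) - (1 - rho) * x (k.+1 * tau).
Proof.
have sT : (tau.-1 < tau)%N by rewrite prednK.
have := local_increment k sT.
case: rec => _ /(_ (k * tau + tau.-1)%N).
have E : ((k * tau + tau.-1).+1 = k.+1 * tau)%N.
  by rewrite -addnS prednK // mulSn addnC.
have E' : (k * tau + tau = k.+1 * tau)%N by rewrite mulSn addnC.
rewrite E modnMl eqxx /slope /drift E' => -> H.
set xs := x (k * tau + tau.-1) in H *.
have -> : xs = x (k.+1 * tau) - (x (k * tau).+1 - x (k * tau)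
  - alpha * (g (k * tau + tau.-1) - g (k * tau))) by lra.
ring.
Qed.

Hypotheses (rho01 : 0 < rho < 1) (disc0 : 0 < mode_disc t rho).

Definition mode_level k := mode_form t rho (x (k.+1 * tau)) (slope k).
Definition local_drift k := \sum_(1 <= s < tau) drift k s ^+ 2.

Lemma drift0 k : drift k 0 = 0.
Proof. by rewrite /drift addn0 subrr mulr0. Qed.

Lemma local_drift_ge0 k : 0 <= local_drift k.
Proof. by apply: sumr_ge0 => s _; apply: sqr_ge0. Qed.

Lemma sum_drift_sqr k s : (1 <= s)%N ->
  (\sum_(s <= r < tau) drift k r) ^+ 2 <= (tau - s)%:R * local_drift k.
Proof.
move=> s1; apply: (le_trans (sqr_sum_le _ _)); rewrite size_iota.
rewrite ler_wpM2l //; have [sT|sT] := leqP s tau; last first.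
  by rewrite big_geq ?local_drift_ge0 // ltnW.
rewrite /local_drift (big_cat_nat s1 sT) /= lerDr.
by apply: sumr_ge0 => r _; apply: sqr_ge0.
Qed.

Lemma period_step k : x (k.+1 * tau) =
  x (k * tau) + t * slope k - \sum_(1 <= s < tau) drift k s.
Proof.
have := period_backward k (leq0n _).
rewrite addn0 subr0 big_ltn // drift0 add0r mulSn addnC; lra.
Qed.

(** Position s is a linear function of the state plus tau - s drifts, hence a sum
    of at most tau terms. *)
Lemma period_energy (A : R) k : 4 * t ^+ 2 <= A * mode_disc t rho ->
  \sum_(1 <= s < tau.+1) x (k * tau + s) ^+ 2
    <= t * (A * rho * mode_level k) + t ^+ 2 * local_drift k.
Proof.
move=> hA; move: rho01 disc0 => /andP[rho0 rho1] hD.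
have t1 : 1 <= t by rewrite ler1n.
have S0 := local_drift_ge0 k.
have A0 : 0 <= A by rewrite -(pmulr_lge0 _ hD); nra.
have bnd s : (1 <= s < tau.+1)%N ->
    x (k * tau + s) ^+ 2 <= A * rho * mode_level k + t * local_drift k.
  move=> /andP[s1 sT]; rewrite ltnS in sT.
  rewrite (period_backward _ sT).
  apply: (le_trans (sqr_add_le _ _ _ (sum_drift_sqr k s1))) => //.
  have s1' : 1 <= s%:R :> R by rewrite ler1n.
  have st' : s%:R <= t by rewrite ler_nat.
  have u01 : 0 <= t - s%:R <= t - 1 by apply/andP; split; lra.
  have := mode_form_coord (x (k.+1 * tau)) (slope k) rho1 hD u01.
  rewrite natrB // -/(mode_level k) [(k.+1 * tau)%N]mulSn [(tau + k * tau)%N]addnC.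
  set a := (x (k * tau + tau) - _) => Ha.
  have HA : t * a ^+ 2 <= A * rho * mode_level k.
    have := ler_wpM2l A0 Ha; have := ler_wpM2r (sqr_ge0 a) hA => H1 H2.
    have t0 : 0 < 4 * t by lra.
    by rewrite -(ler_pM2l t0); lra.
  have : (t - s%:R + 1) * (a ^+ 2 + local_drift k) <= t * (a ^+ 2 + local_drift k).
    by rewrite ler_wpM2r ?addr_ge0 ?sqr_ge0 //; lra.
  move=> H; apply: (le_trans H); lra.
rewrite big_nat; apply: le_trans (ler_sum _ (fun s h => bnd s h)) _.
rewrite -big_nat sumr_const_nat subSS subn0 -mulr_natl; lra.
Qed.

(** The drift that enters slope k: that of the previous period, and none in the
    first one. *)
Definition period_drift k := if k is j.+1 then drift j tau else 0.
Definition forcing_bound k := t * (t * rho ^+ 2 * period_drift k ^+ 2 + (1 - rho) * local_drift k).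

(** (x 0 + t slope 0, slope 0) is the state that the first period would reach
    with frozen gradients. *)
Lemma lyapunov_start r : 0 < r < 1 ->
  mode_level 0 <= mode_form t rho (x 0 + t * slope 0) (slope 0) / r + forcing_bound 0 / (1 - r).
Proof.
move=> r01; move: (rho01) => /andP[rho0 rho1].
rewrite /mode_level period_step mul0n.
rewrite -[X in mode_form _ _ _ X]addr0.
apply: (le_trans (mode_form_convex _ _ _ _ rho1 disc0 r01)).
move: (r01) => /andP[r0 r1].
have ir0 : 0 <= (1 - r)^-1 by rewrite invr_ge0 subr_ge0 ltW.
rewrite lerD2l; apply: (ler_wpM2r ir0).
have := @mode_form_forcing _ t rho 0 (- \sum_(1 <= s < tau) drift 0 s) (local_drift 0).
rewrite !mulr0 add0r; apply=> //; first by rewrite ler1n.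
  exact: local_drift_ge0.
by rewrite sqrrN; have := sum_drift_sqr 0 (leqnn 1); rewrite natrB.
Qed.

(** The state after period k + 1 is the one-period map applied to the previous
    state plus a forcing vector; convexity with weight r = sqrt rho turns the
    factor rho of mode_form_step into r. *)
Lemma lyapunov_step r k : 0 < r < 1 -> r ^+ 2 = rho ->
  mode_level k.+1 <= r * mode_level k + forcing_bound k.+1 / (1 - r).
Proof.
move=> r01 rE; move: (rho01) => /andP[rho0 rho1].
have -> : mode_level k.+1 = mode_form t rho
   ((1 - t * (1 - rho)) * x (k.+1 * tau) + t * rho * slope k
      + (t * rho * (- drift k tau) + - \sum_(1 <= s < tau) drift k.+1 s))
   (rho * slope k - (1 - rho) * x (k.+1 * tau) + rho * (- drift k tau)).
  by rewrite /mode_level period_step slopeS; congr (mode_form _ _ _ _); ring.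
apply: (le_trans (mode_form_convex _ _ _ _ rho1 disc0 r01)).
move: (r01) => /andP[r0 r1].
rewrite mode_form_step -/(mode_level k).
have -> : rho * mode_level k / r = r * mode_level k.
  by rewrite -rE; field; rewrite gt_eqF.
have ir0 : 0 <= (1 - r)^-1 by rewrite invr_ge0 subr_ge0 ltW.
rewrite lerD2l; apply: (ler_wpM2r ir0).
rewrite /forcing_bound /= -[drift k tau ^+ 2]sqrrN.
apply: mode_form_forcing => //; first by rewrite ler1n.
  exact: local_drift_ge0.
by rewrite sqrrN; have := sum_drift_sqr k.+1 (leqnn 1); rewrite natrB.
Qed.

(** The Lyapunov function sums like a geometric series of ratio r. The constants
    A and rb dominate 4 t^2 / mode_disc and sqrt rho simultaneously for all
    modes, so that the bounds of the modes can be added up. *)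
Lemma mode_energy (A rb r : R) K :
  4 * t ^+ 2 <= A * mode_disc t rho -> r ^+ 2 = rho -> 0 < r <= rb -> rb < 1 ->
  \sum_(0 <= k < K.+1) \sum_(1 <= s < tau.+1) x (k * tau + s) ^+ 2
  <= 6 * t ^+ 2 * A / (1 - rb) * (x 0 ^+ 2 + x 1 ^+ 2)
   + t ^+ 2 * A / (1 - rb) ^+ 2 *
       (t * (rb ^+ 2) ^+ 3 * \sum_(0 <= k < K.+1) drift k tau ^+ 2
        + \sum_(0 <= k < K.+1) local_drift k / 4)
   + t ^+ 2 * \sum_(0 <= k < K.+1) local_drift k.
Proof.
move=> hA rE /andP[r0 rrb] rb1; move: (rho01) (disc0) => /andP[rho0 rho1] hD.
have t1 : 1 <= t by rewrite ler1n.
have A0 : 0 <= A by rewrite -(pmulr_lge0 _ hD); nra.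
have r01 : 0 < r < 1 by rewrite r0 (le_lt_trans rrb).
have Vge0 k : 0 <= mode_level k by apply: mode_form_ge0.
apply: (@le_trans _ _ (t * (A * (rho * \sum_(0 <= k < K.+1) mode_level k))
    + t ^+ 2 * \sum_(0 <= k < K.+1) local_drift k)).
  rewrite !mulr_sumr -big_split /=; apply: ler_sum => k _.
  by apply: le_trans (period_energy k hA) _; rewrite !mulrA.
rewrite lerD2r.
have V_sum : (1 - r) * \sum_(0 <= k < K.+1) mode_level k
  <= mode_form t rho (x 0 + t * slope 0) (slope 0) / r + \sum_(0 <= k < K.+1) forcing_bound k / (1 - r).
  apply: geometric_sum_le => //; first by rewrite ltW.
    exact: lyapunov_start.
  by move=> k _; apply: lyapunov_step.
have [D0 Y0] : 0 <= \sum_(0 <= k < K.+1) drift k tau ^+ 2 /\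
    0 <= \sum_(0 <= k < K.+1) local_drift k.
  split; first by apply: sumr_ge0 => k _; apply: sqr_ge0.
  by apply: sumr_ge0 => k _; apply: local_drift_ge0.
have h_sum : \sum_(0 <= k < K.+1) period_drift k ^+ 2 <= \sum_(0 <= k < K.+1) drift k tau ^+ 2.
  rewrite big_nat_recl //= expr0n add0r [leRHS]big_nat_recr //= lerDl.
  exact: sqr_ge0.
(* the frozen state is linear in x 0 and x 1, with no division by rho *)
have P0_le : mode_form t rho (x 0 + t * slope 0) (slope 0) <= 6 * t * (x 0 ^+ 2 + x 1 ^+ 2).
  rewrite /slope mul0n; set u := x 0; set v := x 1.
  have -> : mode_form t rho (u + t * (v - u)) (v - u) = (1 - rho) * u ^+ 2
     + (1 - rho) * (t + 1) * u * (v - u) + t * (v - u) ^+ 2.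
    by rewrite /mode_form; ring.
  have f1 := mulr_ge0 (ltW rho0) (sqr_ge0 u).
  have f2 : 0 <= (1 - rho) * (t + 1) * (u - (v - u)) ^+ 2.
    by apply: mulr_ge0 (sqr_ge0 _); apply: mulr_ge0; lra.
  have f3 : 0 <= rho * (t + 1) * (u ^+ 2 + (v - u) ^+ 2).
    by apply: mulr_ge0 (addr_ge0 (sqr_ge0 _) (sqr_ge0 _)); apply: mulr_ge0; lra.
  have f4 : 0 <= (t - 1) * u ^+ 2 by apply: mulr_ge0 (sqr_ge0 _); lra.
  have f5 : 0 <= (t - 1) * (v - u) ^+ 2 by apply: mulr_ge0 (sqr_ge0 _); lra.
  have f6 : 0 <= t * (v + u) ^+ 2 by apply: mulr_ge0 (sqr_ge0 _); lra.
  have f7 : 0 <= t * v ^+ 2 by apply: mulr_ge0 (sqr_ge0 _); lra.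
  lra.
have b_sum : rho * (\sum_(0 <= k < K.+1) forcing_bound k / (1 - r)) <=
  t * (t * (rb ^+ 2) ^+ 3 * \sum_(0 <= k < K.+1) drift k tau ^+ 2
        + \sum_(0 <= k < K.+1) local_drift k / 4) / (1 - rb).
  have r1 : 0 < 1 - r by case/andP: r01; lra.
  have rb0 : 0 < 1 - rb by lra.
  rewrite -mulr_suml mulrA.
  have -> : \sum_(0 <= k < K.+1) forcing_bound k =
      t * (t * rho ^+ 2 * \sum_(0 <= k < K.+1) period_drift k ^+ 2
           + (1 - rho) * \sum_(0 <= k < K.+1) local_drift k).
    by rewrite !mulr_sumr -big_split /= mulr_sumr.
  have h0 : 0 <= \sum_(0 <= k < K.+1) period_drift k ^+ 2.
    by apply: sumr_ge0 => k _; apply: sqr_ge0.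
  have ? : 0 <= rho * (1 - rho) <= 1 / 4.
    by apply/andP; split; [apply: mulr_ge0; lra | have := sqr_ge0 (2 * rho - 1); lra].
  have ? : 0 <= rho ^+ 3 <= (rb ^+ 2) ^+ 3.
    rewrite exprn_ge0 ?(ltW rho0) //= lerXn2r ?nnegrE ?sqr_ge0 ?(ltW rho0) //.
    by rewrite -rE lerXn2r ?nnegrE // ltW // (lt_le_trans r0).
  set Hh := \sum_(0 <= k < K.+1) period_drift k ^+ 2 in h_sum h0 *.
  set Y := \sum_(0 <= k < K.+1) local_drift k in Y0 *.
  set D := \sum_(0 <= k < K.+1) drift k tau ^+ 2 in h_sum D0 *.
  have e1 : 0 <= t * (rho ^+ 3 * Hh) <= t * ((rb ^+ 2) ^+ 3 * D).
    have ? : 0 <= rho ^+ 3 * Hh <= (rb ^+ 2) ^+ 3 * D.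
      by apply/andP; split; [apply: mulr_ge0; lra | apply: ler_pM; lra].
    by apply/andP; split; [apply: mulr_ge0; lra | apply: ler_pM; lra].
  have e2 : 0 <= rho * (1 - rho) * Y <= Y / 4.
    apply/andP; split; first by apply: mulr_ge0; lra.
    by rewrite [leRHS]mulrC ler_wpM2r //; lra.
  have -> : rho * (t * (t * rho ^+ 2 * Hh + (1 - rho) * Y))
     = t * (t * (rho ^+ 3 * Hh) + rho * (1 - rho) * Y) by ring.
  rewrite -big_distrl /= -/Y; apply: ler_pM.
  - by apply: mulr_ge0; lra.
  - by rewrite invr_ge0 ltW.
  - by apply: ler_wpM2l; lra.
  - by rewrite lef_pV2 ?posrE // lerD2l lerN2.
set P := mode_form _ _ _ _ in V_sum P0_le.
set B := \sum_(0 <= k < K.+1) forcing_bound k / (1 - r) in V_sum b_sum.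
set S := \sum_(0 <= k < K.+1) mode_level k in V_sum *.
set E := (t * _ * _ + _) in b_sum *.
have P_ge0 : 0 <= P by apply: mode_form_ge0.
have S0 : 0 <= S by apply: sumr_ge0.
have ineq : (1 - rb) * (rho * S) <= 6 * t * (x 0 ^+ 2 + x 1 ^+ 2) + t * E / (1 - rb).
  have rhoS : 0 <= rho * S by apply: mulr_ge0; lra.
  have s1 := ler_wpM2r rhoS (_ : 1 - rb <= 1 - r).
  apply: (le_trans (s1 _)); first by lra.
  have s2 := ler_wpM2l (ltW rho0) V_sum.
  have s3 : rho * (P / r) <= P.
    rewrite -rE; have -> : r ^+ 2 * (P / r) = r * P by field; rewrite gt_eqF.
    by rewrite ler_piMl //; lra.
  lra.
have rb0 : 0 < 1 - rb by rewrite subr_gt0.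
rewrite -(ler_pM2l rb0).
have -> : (1 - rb) * (6 * t ^+ 2 * A / (1 - rb) * (x 0 ^+ 2 + x 1 ^+ 2) +
     t ^+ 2 * A / (1 - rb) ^+ 2 * E)
   = t * A * (6 * t * (x 0 ^+ 2 + x 1 ^+ 2) + t * E / (1 - rb)).
  by field; rewrite gt_eqF.
have tA : 0 <= t * A by rewrite mulr_ge0 // (le_trans ler01).
have := ler_wpM2l tA ineq; lra.
Qed.
End ModeRecursion.

(** * Gradients and averages *)

Lemma sqr_fnorm (R : realType) m n (A : 'M[R]_(m, n)) :
  fnorm A ^+ 2 = \sum_i \sum_j A i j ^+ 2.
Proof.
rewrite sqr_sqrtr //; apply: sumr_ge0 => i _; apply: sumr_ge0 => j _.
exact: sqr_ge0.
Qed.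

Lemma sqr_fnorm_col (R : realType) n (u : 'cV[R]_n) :
  fnorm u ^+ 2 = \sum_k u k 0 ^+ 2.
Proof. by rewrite sqr_fnorm; apply: eq_bigr => k _; rewrite big_ord1. Qed.

Lemma derive_grad (R : realType) n (f : 'cV[R]_n -> R) (z d : 'cV[R]_n) :
  differentiable f z -> 'D_d f z = \sum_k grad f z k 0 * d k 0.
Proof.
move=> df; rewrite deriveE // [in LHS](matrix_sum_delta d) linear_sum /=.
apply: eq_bigr => k _; rewrite big_ord1 linearZ /= mxE deriveE // mulrC //.
Qed.

Lemma is_derive_line (R : realType) n (f : 'cV[R]_n -> R) (z d : 'cV[R]_n) (s : R) :
  differentiable f (z + s *: d) ->
  is_derive s 1 (fun s => f (z + s *: d)) (\sum_k grad f (z + s *: d) k 0 * d k 0).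
Proof.
move=> df.
have E : (fun h : R => h^-1 *: (((fun s => f (z + s *: d)) \o shift s) (h *: 1) - f (z + s *: d)))
  = (fun h : R => h^-1 *: ((f \o shift (z + s *: d)) (h *: d) - f (z + s *: d))).
  apply/funext => h /=; congr (_ *: (f _ - _)).
  by rewrite [h *: 1]mulr1 scalerDl addrCA.
apply: DeriveDef; first by rewrite /derivable E; apply: diff_derivable.
by rewrite -derive_grad // /derive E.
Qed.

(** Along the segment the difference between f and the quadratic bound has
    derivative <grad f (z + s d) - grad f z, d> - L s |d|^2, which is nonpositive
    by Cauchy-Schwarz and the Lipschitz condition. *)
Lemma descent_lemma (R : realType) n (f : 'cV[R]_n -> R) (L : R) :
  0 < L -> (forall z, differentiable f z) ->
  (forall y z, fnorm (grad f y - grad f z) ^+ 2 <= L ^+ 2 * fnorm (y - z) ^+ 2) ->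
  forall z d : 'cV[R]_n,
  f (z + d) <= f z + \sum_k grad f z k 0 * d k 0 + L / 2 * fnorm d ^+ 2.
Proof.
move=> L0 df lip z d.
set c := \sum_k _ ; set q := fnorm d ^+ 2.
pose phi (s : R) := f (z + s *: d) - (c * s + L / 2 * q * s ^+ 2).
have dphi (s : R) : is_derive s 1 phi
   (\sum_k grad f (z + s *: d) k 0 * d k 0 - (c + L * q * s)).
  have h := is_derive_line (df (z + s *: d)).
  rewrite /phi; apply: is_derive_eq.
  have scaleE (a b : R^o) : a *: b = a * b by [].
  by rewrite !scaleE; field.
have q0 : 0 <= q by apply: sqr_ge0.
have phi_le : phi 1 <= phi 0.
  apply: (@ler0_derive1_le_cc _ phi 0 1); rewrite ?in_itv /= ?lexx ?ler01 //.
  - move=> s; rewrite in_itv /= => /andP[s0 s1].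
    rewrite derive1E derive_val opprD addrA subr_le0 -sumrB.
    have Ls : 0 < L * s by rewrite mulr_gt0.
    have := lip (z + s *: d) z.
    have -> : fnorm (z + s *: d - z) ^+ 2 = s ^+ 2 * q.
      rewrite addrC addKr /q !sqr_fnorm_col mulr_sumr.
      by apply: eq_bigr => k _; rewrite mxE exprMn.
    rewrite sqr_fnorm_col => lip2.
    rewrite -(ler_pM2l (_ : 0 < 2 * (L * s))); last by rewrite mulr_gt0.
    apply: (@le_trans _ _ (\sum_k (grad f (z + s *: d) - grad f z) k 0 ^+ 2
                       + (L * s) ^+ 2 * q)); last first.
      have -> : 2 * (L * s) * (L * q * s)
          = L ^+ 2 * (s ^+ 2 * q) + (L * s) ^+ 2 * q by ring.
      by rewrite lerD2r.
    rewrite /q sqr_fnorm_col !mulr_sumr -big_split; apply: ler_sum => k _ /=.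
    set g1 := grad f (z + _); set g2 := grad f z.
    have -> : (g1 - g2) k 0 = g1 k 0 - g2 k 0 by rewrite mxE [X in _ + X]mxE.
    rewrite -subr_ge0; set D := (X in 0 <= X).
    have -> : D = (g1 k 0 - g2 k 0 - L * s * d k 0) ^+ 2 by rewrite /D; ring.
    exact: sqr_ge0.
  - by apply: derivable_within_continuous => s _.
move: phi_le; rewrite /phi scale1r scale0r addr0; lra.
Qed.

Lemma favgE (R : realType) N n (f : 'I_N -> 'cV[R]_n -> R) :
  favg f = N%:R^-1 \*: \sum_i f i.
Proof. by apply/funext => y; rewrite /favg /= fct_sumE. Qed.

Lemma differentiable_favg (R : realType) N n (f : 'I_N -> 'cV[R]_n -> R) y :
  (forall i, differentiable (f i) y) -> differentiable (favg f) y.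
Proof.
by move=> df; rewrite favgE; apply: differentiableZ; apply: differentiable_sum.
Qed.

Lemma grad_favg (R : realType) N n (f : 'I_N -> 'cV[R]_n -> R) y :
  (forall i, differentiable (f i) y) ->
  grad (favg f) y = avg (fun i => grad (f i) y).
Proof.
move=> df; have dv i v : derivable (f i) y v by exact/diff_derivable.
apply/colP => k; rewrite favgE !mxE deriveZ; last exact: derivable_sum.
by rewrite derive_sum // summxE; congr (_ * _); apply: eq_bigr => i _; rewrite mxE.
Qed.

Lemma sqr_fnorm_stack (R : realType) N n (z : 'I_N -> 'cV[R]_n) :
  fnorm (stack z) ^+ 2 = \sum_i fnorm (z i) ^+ 2.
Proof.
rewrite sqr_fnorm exchange_big; apply: eq_bigr => i _.
by rewrite sqr_fnorm_col; apply: eq_bigr => k _; rewrite mxE.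
Qed.

Lemma avg_mxE (R : realType) N n (z : 'I_N -> 'cV[R]_n) k :
  avg z k 0 = N%:R^-1 * \sum_i z i k 0.
Proof. by rewrite mxE summxE. Qed.

Lemma sqr_fnorm_deviation (R : realType) N n (z : 'I_N -> 'cV[R]_n) : (0 < N)%N ->
  \sum_i fnorm (z i - avg z) ^+ 2
    = fnorm (stack z) ^+ 2 - N%:R * fnorm (avg z) ^+ 2.
Proof.
move=> N0; have N0' : N%:R != 0 :> R by rewrite pnatr_eq0 -lt0n.
rewrite sqr_fnorm_col mulr_sumr sqr_fnorm -sumrB.
under eq_bigr => i _ do rewrite sqr_fnorm_col.
rewrite exchange_big; apply: eq_bigr => k _ /=.
have zE : \sum_i z i k 0 = N%:R * avg z k 0 by rewrite avg_mxE mulVKf.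
transitivity (\sum_i (z i k 0 ^+ 2 + (avg z k 0 ^+ 2 - 2 * avg z k 0 * z i k 0))).
  by apply: eq_bigr => i _; rewrite mxE [X in _ + X]mxE; ring.
rewrite !big_split sumrN sumr_const card_ord -mulr_sumr zE /= -mulr_natl.
congr (_ + _); last by ring.
by apply: eq_bigr => i _; rewrite mxE.
Qed.

Lemma sqr_fnorm_avg_le (R : realType) N n (z : 'I_N -> 'cV[R]_n) : (0 < N)%N ->
  N%:R * fnorm (avg z) ^+ 2 <= \sum_i fnorm (z i) ^+ 2.
Proof.
move=> N0; rewrite -sqr_fnorm_stack -subr_ge0 -sqr_fnorm_deviation //.
by apply: sumr_ge0 => i _; apply: sqr_ge0.
Qed.

Lemma avgB (R : realType) N n (z w : 'I_N -> 'cV[R]_n) :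
  avg (fun i => z i - w i) = avg z - avg w.
Proof. by rewrite /avg sumrB scalerBr. Qed.

Section Gradients.
Variables (R : realType) (N n : nat) (f : 'I_N -> 'cV[R]_n -> R) (L : R).
Hypotheses (N0 : (0 < N)%N) (df : forall i y, differentiable (f i) y).
Hypothesis lip : forall i y z,
  fnorm (grad (f i) y - grad (f i) z) ^+ 2 <= L ^+ 2 * fnorm (y - z) ^+ 2.

Lemma sum_grad_lip (z w : 'I_N -> 'cV[R]_n) :
  \sum_i fnorm (grad (f i) (z i) - grad (f i) (w i)) ^+ 2
    <= L ^+ 2 * \sum_i fnorm (z i - w i) ^+ 2.
Proof. by rewrite mulr_sumr; apply: ler_sum => i _. Qed.

(** The gradient of the average function at one point against the average of the
    local gradients at different points: the error is paid by the spread of the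
    points. *)
Lemma grad_favg_consensus (y : 'cV[R]_n) (z : 'I_N -> 'cV[R]_n) :
  N%:R * fnorm (grad (favg f) y - avg (fun i => grad (f i) (z i))) ^+ 2
    <= L ^+ 2 * \sum_i fnorm (y - z i) ^+ 2.
Proof.
rewrite (grad_favg (fun i => df i y)) -avgB.
by apply: (le_trans (sqr_fnorm_avg_le _ N0)); apply: sum_grad_lip.
Qed.

Lemma grad_favg_lip y z :
  fnorm (grad (favg f) y - grad (favg f) z) ^+ 2 <= L ^+ 2 * fnorm (y - z) ^+ 2.
Proof.
have Npos : 0 < N%:R :> R by rewrite ltr0n.
rewrite -(ler_pM2l Npos) [X in _ - X](grad_favg (fun i => df i z)).
apply: le_trans (grad_favg_consensus y (fun=> z)) _.
by rewrite sumr_const card_ord mulr_natl mulrnAr.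
Qed.

(** The descent lemma for the step - alpha g, with 2 <G, g> written as
    |G|^2 + |g|^2 - |G - g|^2 and the last term bounded by the consensus error. *)
Lemma gradient_step_descent (alpha : R) (z : 'I_N -> 'cV[R]_n) :
  0 < L -> 0 < alpha ->
  let g := avg (fun i => grad (f i) (z i)) in
  alpha * fnorm (grad (favg f) (avg z)) ^+ 2
  <= 2 * (favg f (avg z) - favg f (avg z - alpha *: g))
     - alpha * (1 - alpha * L) * fnorm g ^+ 2
     + alpha * L ^+ 2 / N%:R * (fnorm (stack z) ^+ 2 - N%:R * fnorm (avg z) ^+ 2).
Proof.
move=> L0 a0 /=; set g := avg (fun i => grad _ _).
have Npos : 0 < N%:R :> R by rewrite ltr0n.
have dF y : differentiable (favg f) y by apply: differentiable_favg => i.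
have := descent_lemma L0 dF grad_favg_lip (avg z) (- (alpha *: g)).
have := grad_favg_consensus (avg z) z; rewrite -/g.
have -> : \sum_i fnorm (avg z - z i) ^+ 2 =
   fnorm (stack z) ^+ 2 - N%:R * fnorm (avg z) ^+ 2.
  rewrite -sqr_fnorm_deviation //; apply: eq_bigr => i _.
  by rewrite !sqr_fnorm_col; apply: eq_bigr => k _; rewrite -sqrrN !mxE; ring.
set D := _ - N%:R * _; set G := grad _ (avg z).
have -> : fnorm (- (alpha *: g)) ^+ 2 = alpha ^+ 2 * fnorm g ^+ 2.
  rewrite !sqr_fnorm_col mulr_sumr; apply: eq_bigr => k _.
  by rewrite !mxE; ring.
have -> : \sum_k G k 0 * (- (alpha *: g)) k 0 = - alpha * \sum_k G k 0 * g k 0.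
  by rewrite mulr_sumr; apply: eq_bigr => k _; rewrite !mxE; ring.
have -> : fnorm (G - g) ^+ 2
    = fnorm G ^+ 2 + fnorm g ^+ 2 - 2 * \sum_k G k 0 * g k 0.
  rewrite !sqr_fnorm_col mulr_sumr -big_split -sumrB /=; apply: eq_bigr => k _.
  by rewrite mxE [X in _ + X]mxE; ring.
set dot := \sum_k _; set G2 := fnorm G ^+ 2; set g2 := fnorm g ^+ 2.
rewrite -ler_pdivlMl // => H1 H2.
have := ler_wpM2l (ltW a0) H1.
have -> : alpha * (N%:R^-1 * (L ^+ 2 * D)) = alpha * L ^+ 2 / N%:R * D by ring.
lra.
Qed.
End Gradients.

(** * Modal coordinates of a run *)

(** The rows of P are unit eigenvectors. Evaluating the two definiteness
    conditions on them puts the eigenvalues in (-1, 1]. The constants are fixed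
    by W, so 1 is an eigenvalue, hence the first one of the sorted list. An
    eigenvector for 1 has constant entries, so a second eigenvalue 1 would give
    two orthogonal rows with constant nonzero entries. *)
Lemma mixing_spectrum (R : realType) N (e : rel 'I_N.+2) (W : 'M[R]_N.+2) lam :
  mixing_matrix e W -> eigenvalue_list W lam ->
  exists P : 'M[R]_N.+2,
    [/\ P *m P^T = 1%:M, W = P^T *m diag_mx (\row_i lam`_i) *m P,
        forall j, P 0 j = P 0 0, lam`_0 = 1 /\ lam`_1 < 1
      & forall i : 'I_N.+2, i != 0 -> - 1 < lam`_i <= lam`_1].
Proof.
case=> _ symW nullW [psd pd] [sorted_lam charW].
have [P [PP WE]] := symmetric_diagonalization symW charW.
have PTP : P^T *m P = 1%:M by apply: mulmx1C.
have PW : P *m W = diag_mx (\row_i lam`_i) *m P.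
  by rewrite WE !mulmxA PP mul1mx.
pose v i : 'cV_N.+2 := (row i P)^T.
have vE i j : v i j 0 = P i j by rewrite !mxE.
have Wv i : W *m v i = lam`_i *: v i.
  apply: trmx_inj; rewrite trmx_mul symW linearZ /= !trmxK -row_mul PW.
  by apply/rowP => j; rewrite mxE mul_diag_mx !mxE.
have PPE i j : \sum_k P i k * P j k = (i == j)%:R.
  have /matrixP/(_ i j) := PP; rewrite !mxE => <-.
  by apply: eq_bigr => k _; rewrite mxE.
have vv i : (v i)^T *m v i = 1%:M.
  rewrite [LHS]mx11_scalar mxE; congr (_%:M); transitivity (\sum_k P i k * P i k); last by rewrite PPE eqxx.
  by apply: eq_bigr => k _; rewrite mxE !vE.
have vquad i : ((v i)^T *m (W + 1%:M) *m v i) 0 0 = lam`_i + 1.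
  by rewrite -mulmxA mulmxDl Wv mul1mx mulmxDr -scalemxAr vv !mxE mulr1.
have v0 i : v i != 0.
  apply/eqP => vi0; have := vv i; rewrite vi0 mulmx0 => /matrixP/(_ 0 0).
  by rewrite !mxE => /eqP; rewrite eq_sym oner_eq0.
have lam_gt (i : 'I_N.+2) : -1 < lam`_i.
  by have := pd.2 (v i) (v0 i); rewrite vquad -ltrBlDr sub0r.
have lam_le (i : 'I_N.+2) : lam`_i <= 1.
  have := psd.2 (v i); rewrite mulmxBr mulmxBl mxE [X in _ + X]mxE vquad.
  rewrite mul_mx_scalar -scalemxAl vv !mxE eqxx !mulr1n. lra.
have size_lam : size lam = N.+2.
  by have := size_char_poly W; rewrite charW size_prod_XsubC => -[].
have lam_sorted i j : (i <= j < N.+2)%N -> lam`_j <= lam`_i.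
  move=> /andP[ij jN].
  apply: (sorted_leq_nth (leT := fun x y : R => y <= x)) => //.
  - by move=> a b c /= ab bc; apply: le_trans bc ab.
  - by rewrite inE size_lam (leq_ltn_trans ij).
  - by rewrite inE size_lam.
have const_row (i : 'I_N.+2) : lam`_i = 1 -> forall j, P i j = P i 0.
  move=> li; have [|c vc] := (nullW (v i)).1.
    by rewrite mulmxBl mul1mx Wv li scale1r subrr.
  by move=> j; rewrite -!vE vc !mxE.
have lam0 : lam`_0 = 1.
  apply/eqP; rewrite eq_le (lam_le 0) /=.
  pose w : 'cV[R]_N.+2 := P *m const_mx 1.
  have w0 : w != 0.
    apply/eqP => w0; have : P^T *m w = 0 by rewrite w0 mulmx0.
    rewrite mulmxA PTP mul1mx => /matrixP/(_ 0 0); rewrite !mxE.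
    by apply/eqP; rewrite oner_eq0.
  have [i wi] : exists i, w i 0 != 0.
    by case/matrix0Pn: w0 => i [j]; rewrite ord1; exists i.
  have W1 : W *m const_mx 1 = const_mx 1 :> 'cV_N.+2.
    have := (nullW (const_mx 1)).2; rewrite mulmxBl mul1mx => H.
    by apply/esym/subr0_eq/H; exists 1; rewrite scale1r.
  have /colP/(_ i) : diag_mx (\row_i lam`_i) *m w = w by rewrite mulmxA -PW -mulmxA W1.
  rewrite mul_diag_mx mxE mxE => /eqP.
  rewrite -subr_eq0 -[X in _ - X]mul1r -mulrBl mulf_eq0 (negbTE wi) orbF subr_eq0.
  by move=> /eqP <-; apply: lam_sorted; rewrite ltn_ord.
exists P; split => //; first exact: const_row 0 lam0.
- split=> //; rewrite lt_neqAle (lam_le 1) andbT; apply/eqP => lam1.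
  have c0 := const_row 0 lam0; have c1 := const_row 1 lam1.
  have PPc i j a b : (forall k, P i k = a) -> (forall k, P j k = b) ->
      N.+2%:R * (a * b) = (i == j)%:R.
    move=> ia jb; rewrite -PPE; under [RHS]eq_bigr => k _ do rewrite ia jb.
    by rewrite sumr_const card_ord mulr_natl.
  have := PPc _ _ _ _ c0 c1; have := PPc _ _ _ _ c0 c0; have := PPc _ _ _ _ c1 c1.
  rewrite !eqxx /= => h1 h2 /eqP.
  rewrite !mulf_eq0 pnatr_eq0 /= => /orP[]/eqP h; rewrite h !mulr0 in h1 h2.
  + by move/eqP: h2; rewrite eq_sym oner_eq0.
  + by move/eqP: h1; rewrite eq_sym oner_eq0.
- move=> i i0; rewrite lam_gt /=; apply: lam_sorted.
  by rewrite ltn_ord andbT lt0n.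
Qed.

(** The squared consensus error. *)
Definition dispersion (R : realType) N n (z : 'I_N -> 'cV[R]_n) : R :=
  \sum_i fnorm (z i - avg z) ^+ 2.

Lemma dispersion_ge0 (R : realType) N n (z : 'I_N -> 'cV[R]_n) : 0 <= dispersion z.
Proof. by apply: sumr_ge0 => i _; apply: sqr_ge0. Qed.

Lemma sqr_fnorm_stackE (R : realType) N n (z : 'I_N -> 'cV[R]_n) : (0 < N)%N ->
  fnorm (stack z) ^+ 2 = dispersion z + N%:R * fnorm (avg z) ^+ 2.
Proof. by move=> N0; rewrite /dispersion sqr_fnorm_deviation // subrK. Qed.

Lemma dispersion_le (R : realType) N n (z : 'I_N -> 'cV[R]_n) : (0 < N)%N ->
  dispersion z <= fnorm (stack z) ^+ 2.
Proof. by move=> N0; rewrite sqr_fnorm_stackE // lerDl mulr_ge0 // sqr_ge0. Qed.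

Lemma sqr_fnorm_sub_le (R : realType) m n (A B : 'M[R]_(m, n)) :
  fnorm (A - B) ^+ 2 <= 2 * fnorm A ^+ 2 + 2 * fnorm B ^+ 2.
Proof.
rewrite !sqr_fnorm !mulr_sumr -big_split; apply: ler_sum => i _ /=.
rewrite !mulr_sumr -big_split; apply: ler_sum => j _ /=.
by rewrite mxE [X in _ + X]mxE; have := sqr_ge0 (A i j + B i j); lra.
Qed.

Lemma dispersion_sub_le (R : realType) N n (z w : 'I_N -> 'cV[R]_n) :
  dispersion (fun i => z i - w i) <= 2 * dispersion z + 2 * dispersion w.
Proof.
rewrite /dispersion !mulr_sumr -big_split; apply: ler_sum => i _ /=.
rewrite avgB; have -> : z i - w i - (avg z - avg w) = z i - avg z - (w i - avg w).
  by rewrite !opprB addrACA [RHS]addrACA; congr (_ + _); rewrite addrC.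
exact: sqr_fnorm_sub_le.
Qed.

Section Modal.
Variables (R : realType) (N n : nat) (P : 'M[R]_N.+1).
Implicit Types z w : 'I_N.+1 -> 'cV[R]_n.

Definition modal z (k : 'I_n) (i : 'I_N.+1) : R := \sum_j z j k 0 * P i j.

Lemma modalE z k i : modal z k i = (stack z *m P^T) k i.
Proof. by rewrite mxE; apply: eq_bigr => j _; rewrite !mxE. Qed.

Lemma modalB z w k i : modal z k i - modal w k i = modal (fun j => z j - w j) k i.
Proof. by rewrite /modal -sumrB; apply: eq_bigr => j _; rewrite !mxE mulrBl. Qed.

Hypotheses (PP : P *m P^T = 1%:M) (P0 : forall j, P 0 j = P 0 0).

Lemma modal_sqr_sum z : \sum_i \sum_k modal z k i ^+ 2 = fnorm (stack z) ^+ 2.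
Proof.
have tr (A : 'M[R]_(n, N.+1)) : fnorm A ^+ 2 = \tr (A *m A^T).
  rewrite sqr_fnorm; apply: eq_bigr => k _; rewrite mxE.
  by apply: eq_bigr => i _; rewrite mxE expr2.
rewrite exchange_big; under eq_bigr => k _ do under eq_bigr => i _ do rewrite modalE.
rewrite -sqr_fnorm !tr trmx_mul trmxK mulmxA -[_ *m P^T *m P]mulmxA.
by rewrite (mulmx1C PP) mulmx1.
Qed.

(** The first row of P is a unit vector with constant entries. *)
Lemma mean_coef : N.+1%:R * P 0 0 ^+ 2 = 1.
Proof.
have /matrixP/(_ 0 0) := PP; rewrite !mxE eqxx.
under eq_bigr => k _ do rewrite mxE (P0 k) -expr2.
by rewrite sumr_const card_ord mulr_natl.
Qed.

Lemma modal_mean z k : modal z k 0 = N.+1%:R * P 0 0 * avg z k 0.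
Proof.
rewrite /modal; under eq_bigr => j _ do rewrite (P0 j).
rewrite -mulr_suml avg_mxE mulrAC mulrA mulfV ?mul1r // pnatr_eq0 //.
Qed.

(** Orthogonality of P preserves the total energy, and the mode of the constant
    eigenvector carries exactly the mean. *)
Lemma modal_dispersion z :
  \sum_(i | i != 0) \sum_k modal z k i ^+ 2 = dispersion z.
Proof.
rewrite /dispersion sqr_fnorm_deviation // -modal_sqr_sum [in RHS](bigD1 0) //=.
rewrite addrAC -[LHS]add0r; congr (_ + _); apply/esym/eqP; rewrite subr_eq0.
rewrite sqr_fnorm_col mulr_sumr; apply/eqP/eq_bigr => k _; rewrite modal_mean.
have sqE (c p a : R) : (c * p * a) ^+ 2 = c * (c * p ^+ 2) * a ^+ 2 by ring.
by rewrite sqE mean_coef mulr1.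
Qed.

Lemma modal_mixing (M : 'M[R]_N.+1) (d : 'rV_N.+1) z k i :
  P *m M = diag_mx d *m P -> M^T = M ->
  modal (fun j => \sum_l M j l *: z l) k i = d 0 i * modal z k i.
Proof.
move=> PM symM; rewrite /modal.
transitivity (\sum_j \sum_l z l k 0 * (P i j * M j l)).
  apply: eq_bigr => j _; rewrite summxE mulr_suml; apply: eq_bigr => l _.
  by rewrite mxE; ring.
rewrite exchange_big mulr_sumr; apply: eq_bigr => l _ /=; rewrite -mulr_sumr.
have /matrixP/(_ i l) := PM; rewrite mul_diag_mx !mxE => ->; ring.
Qed.
End Modal.

Lemma lazy_mxE (R : realType) N (xi : R) (W : 'M[R]_N) :
  lazy_mx xi W = (1 - xi)%:M + xi *: W.
Proof.
apply/matrixP => i j; rewrite !mxE.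
by case: eqVneq => [->|_]; rewrite ?mulr1n // mulr0n add0r.
Qed.

Lemma MILE_modal (R : realType) N n tau (xi alpha : R) (W : 'M[R]_N.+1)
    (f : 'I_N.+1 -> 'cV[R]_n -> R) x (P : 'M[R]_N.+1) (lam : seq R) (k : 'I_n) (i : 'I_N.+1) :
  MILE tau xi alpha W f x -> W^T = W -> P *m W = diag_mx (\row_i lam`_i) *m P ->
  mode_recursion tau (1 - xi + xi * lam`_i) alpha
    (fun t => modal P (x t%:Z) k i)
    (fun t => modal P (fun j => grad (f j) (x t%:Z j)) k i).
Proof.
move=> [x0 xS] symW PW.
have PL : P *m lazy_mx xi W = diag_mx (\row_i (1 - xi + xi * lam`_i)) *m P.
  rewrite lazy_mxE mulmxDr mul_mx_scalar -scalemxAr PW; apply/matrixP => a b.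
  by rewrite [LHS]mxE [X in X + _]mxE [X in _ + X]mxE !mul_diag_mx !mxE; ring.
have symL : (lazy_mx xi W)^T = lazy_mx xi W.
  by rewrite lazy_mxE linearD linearZ /= symW tr_scalar_mx.
have stepE (t : int) : modal P (local_step f alpha x t) k i =
    2 * modal P (x t) k i - modal P (x (t - 1)) k i
    - alpha * modal P (fun j => grad (f j) (x t j)) k i
    + alpha * modal P (fun j => grad (f j) (x (t - 1) j)) k i.
  rewrite /modal !mulr_sumr -sumrB -sumrB -big_split; apply: eq_bigr => j _ /=.
  by rewrite /local_step !mxE; ring.
have rec (t : nat) : modal P (x (t%:Z + 1)) k i =
    (if (t %% tau == 0)%N then 1 - xi + xi * lam`_i else 1)
    * modal P (local_step f alpha x t%:Z) k i.
  have -> : x (t%:Z + 1) = fun j => if (t %% tau == 0)%N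
      then \sum_l lazy_mx xi W j l *: local_step f alpha x t%:Z l
      else local_step f alpha x t%:Z j by apply/funext => j; apply: xS.
  case: ifP => _; last by rewrite mul1r.
  by rewrite (modal_mixing _ _ _ PL symL) mxE.
split.
  have := rec 0%N; rewrite mod0n add0r => ->; rewrite stepE sub0r.
  have -> : modal P (x 0) k i = modal P (x (- 1)) k i
      - alpha * modal P (fun j => grad (f j) (x (- 1) j)) k i.
    rewrite /modal mulr_sumr -sumrB; apply: eq_bigr => j _.
    by rewrite x0 !mxE; ring.
  rewrite eqxx; ring.
move=> s; rewrite (_ : s.+2%:Z = s.+1%:Z + 1); last by lia.
by rewrite rec stepE (_ : s.+1%:Z - 1 = s%:Z) //; lia.
Qed.

(** * Consensus energy of a run *)

Lemma sum_by_periods0 (V : nmodType) tau K (F : nat -> V) :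
  \sum_(0 <= s < K * tau) F s
    = \sum_(0 <= k < K) \sum_(0 <= s < tau) F (k * tau + s)%N.
Proof.
elim: K => [|K IH]; first by rewrite mul0n !big_geq.
rewrite [RHS]big_nat_recr //= -IH mulSnr.
rewrite (@big_cat_nat _ _ _ (K * tau)) //=; last exact: leq_addr.
congr (_ + _); rewrite -{1}[(K * tau)%N]add0n big_addn addKn.
by apply: eq_bigr => s _; rewrite addnC.
Qed.

(** Each period k contributes its times k tau + 1, ..., k tau + tau, matching
    period_energy. *)
Lemma sum_by_periods (V : nmodType) tau K (F : nat -> V) :
  \sum_(1 <= s < (K * tau).+1) F s
    = \sum_(0 <= k < K) \sum_(1 <= s < tau.+1) F (k * tau + s)%N.
Proof.
rewrite big_add1 /= sum_by_periods0; apply: eq_bigr => k _.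
by rewrite [RHS]big_add1; apply: eq_bigr => s _; rewrite addnS.
Qed.

Lemma sum_period_starts (R : realFieldType) tau K (c : nat -> R) :
  (1 <= tau)%N -> (forall s, 0 <= c s) ->
  \sum_(0 <= k < K.+1) c (k * tau)%N
    <= c 0 + \sum_(0 <= k < K.+1) \sum_(1 <= s < tau.+1) c (k * tau + s)%N.
Proof.
move=> tau1 c0; rewrite big_nat_recl // mul0n lerD2l.
rewrite [leRHS]big_nat_recr //= -[leLHS]addr0; apply: lerD; last first.
  by apply: sumr_ge0 => s _.
apply: ler_sum => k _; rewrite mulSnr big_nat_recr //= lerDr.
by apply: sumr_ge0.
Qed.

Lemma le_sum_term (R : realFieldType) m n s (F : nat -> R) :
  (m <= s < n)%N -> (forall k, 0 <= F k) -> F s <= \sum_(m <= k < n) F k.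
Proof.
move=> smn F0; rewrite (bigD1_seq s) ?mem_index_iota ?iota_uniq //= lerDl.
exact: sumr_ge0.
Qed.

Section Run.
Variables (R : realType) (N n tau : nat) (xi alpha L : R) (W P : 'M[R]_N.+1).
Variables (f : 'I_N.+1 -> 'cV[R]_n -> R) (x : int -> 'I_N.+1 -> 'cV[R]_n).
Variable lam : seq R.
Hypotheses (tau1 : (1 <= tau)%N) (run : MILE tau xi alpha W f x).
Hypotheses (symW : W^T = W) (PW : P *m W = diag_mx (\row_i lam`_i) *m P).
Hypotheses (PP : P *m P^T = 1%:M) (P0 : forall j, P 0 j = P 0 0).
Hypotheses (lam0 : lam`_0 = 1).
Hypothesis lip : forall i y z,
  fnorm (grad (f i) y - grad (f i) z) ^+ 2 <= L ^+ 2 * fnorm (y - z) ^+ 2.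

Definition gradients (t : nat) := fun j => grad (f j) (x t%:Z j).
Definition mean_grad (t : nat) : R := N.+1%:R * fnorm (avg (gradients t)) ^+ 2.

Lemma mean_grad_ge0 t : 0 <= mean_grad t.
Proof. by rewrite mulr_ge0 ?sqr_ge0. Qed.

(** For the eigenvalue 1 mixing has no effect, and the increments
    x s.+1 - x s + alpha g s are all equal to the first one, which vanishes. *)
Lemma mean_step (t : nat) :
  avg (x t.+1%:Z) = avg (x t%:Z) - alpha *: avg (gradients t).
Proof.
apply/colP => k; rewrite [RHS]mxE [X in _ + X]mxE [X in _ - X]mxE.
have := MILE_modal (lam := lam) k (0 : 'I_N.+1) run symW PW.
rewrite (_ : 1 - xi + xi * _ = 1); last by rewrite [nth _ _ _]lam0; ring.
move=> [rec0 recS].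
have coef_neq0 : N.+1%:R * P 0 0 != 0.
  apply/eqP => c0; have := mean_coef PP P0.
  by rewrite expr2 mulrA c0 mul0r => /eqP; rewrite eq_sym oner_eq0.
apply: (mulfI coef_neq0); rewrite mulrBr [_ * (alpha * _)]mulrCA -!modal_mean //.
elim: t => [|t IH]; first by rewrite rec0 mul1r.
rewrite recS; case: ifP => _; rewrite mul1r IH /gradients; ring.
Qed.

(** The mean moves by - alpha times the mean gradient at each step; Cauchy-Schwarz
    over at most tau steps. *)
Lemma mean_drift m s : (s <= tau)%N ->
  N.+1%:R * fnorm (avg (x (m + s)%N%:Z) - avg (x m%:Z)) ^+ 2
    <= alpha ^+ 2 * tau%:R * \sum_(0 <= r < tau) mean_grad (m + r)%N.
Proof.
move=> sT.
have -> : avg (x (m + s)%N%:Z) - avg (x m%:Z)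
    = \sum_(0 <= r < s) - alpha *: avg (gradients (m + r)).
  elim: s {sT} => [|s IH]; first by rewrite addn0 subrr big_geq.
  by rewrite big_nat_recr //= -IH addnS mean_step scaleNr addrAC.
rewrite -scaler_sumr.
set g := \sum_(0 <= r < s) _.
have -> : fnorm (- alpha *: g) ^+ 2 = alpha ^+ 2 * fnorm g ^+ 2.
  rewrite !sqr_fnorm_col mulr_sumr; apply: eq_bigr => k _.
  by rewrite mxE exprMn sqrrN.
have g_le : fnorm g ^+ 2 <= tau%:R * \sum_(0 <= r < tau) fnorm (avg (gradients (m + r))) ^+ 2.
  rewrite sqr_fnorm_col.
  apply: (@le_trans _ _ (s%:R * \sum_(0 <= r < s) fnorm (avg (gradients (m + r))) ^+ 2)).
    under [X in _ <= _ * X]eq_bigr => r _ do rewrite sqr_fnorm_col.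
    rewrite exchange_big /= mulr_sumr; apply: ler_sum => k _.
    by rewrite summxE; apply: le_trans (sqr_sum_le _ _) _; rewrite size_iota subn0.
  apply: ler_pM => //; first by apply: sumr_ge0 => r _; apply: sqr_ge0.
    by rewrite ler_nat.
  rewrite [leRHS](@big_cat_nat _ _ _ s) //= lerDl.
  by apply: sumr_ge0 => r _; apply: sqr_ge0.
have -> : \sum_(0 <= r < tau) mean_grad (m + r)
   = N.+1%:R * \sum_(0 <= r < tau) fnorm (avg (gradients (m + r))) ^+ 2.
  by rewrite mulr_sumr.
have aN : 0 <= alpha ^+ 2 * N.+1%:R by rewrite mulr_ge0 ?sqr_ge0.
have := ler_wpM2l aN g_le; lra.
Qed.

(** By the Lipschitz condition the gradients drift at most as much as the
    iterates, whose displacement splits into a dispersion part and the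
    displacement of the mean. *)
Lemma grad_drift m s : (s <= tau)%N ->
  dispersion (fun j => gradients (m + s)%N j - gradients m j)
  <= L ^+ 2 * (2 * dispersion (x (m + s)%N%:Z) + 2 * dispersion (x m%:Z)
       + alpha ^+ 2 * tau%:R * \sum_(0 <= r < tau) mean_grad (m + r)%N).
Proof.
move=> sT; apply: (le_trans (dispersion_le _ _)) => //.
rewrite sqr_fnorm_stack.
apply: (le_trans (sum_grad_lip lip (x (m + s)%N%:Z) (x m%:Z))).
apply: ler_wpM2l; first exact: sqr_ge0.
rewrite -(sqr_fnorm_stack (fun i => x (m + s)%N%:Z i - x m%:Z i)).
rewrite sqr_fnorm_stackE // avgB; apply: lerD; last exact: mean_drift.
exact: dispersion_sub_le.
Qed.

Lemma sum_grad_drift K s : (1 <= s <= tau)%N ->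
  \sum_(0 <= k < K.+1) dispersion (fun j => gradients (k * tau + s)%N j - gradients (k * tau)%N j)
  <= L ^+ 2 * (4 * (dispersion (x 0) + \sum_(1 <= t < (K.+1 * tau).+1) dispersion (x t%:Z))
     + alpha ^+ 2 * tau%:R * \sum_(0 <= t < K.+1 * tau) mean_grad t).
Proof.
move=> /andP[s1 sT].
apply: (le_trans (ler_sum _ (fun k _ => grad_drift (k * tau) sT))).
set U := \sum_(0 <= t < K.+1 * tau) mean_grad t.
rewrite -mulr_sumr ler_wpM2l ?sqr_ge0 // !big_split -!mulr_sumr /=.
rewrite sum_by_periods.
have := sum_period_starts K tau1 (fun t => dispersion_ge0 (x t%:Z)).
set E := \sum_(0 <= k < K.+1) \sum_(1 <= s < tau.+1) _.
have : \sum_(0 <= k < K.+1) dispersion (x (k * tau + s)%N%:Z) <= E.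
  apply: ler_sum => k _.
  apply: (le_sum_term (F := fun s => dispersion (x (k * tau + s)%N%:Z))).
    by rewrite s1 ltnS.
  by move=> r; apply: dispersion_ge0.
have <- : U = \sum_(0 <= k < K.+1) \sum_(0 <= r < tau) mean_grad (k * tau + r).
  exact: sum_by_periods0.
have := dispersion_ge0 (x 0).
set a := \sum_(0 <= k < K.+1) dispersion _; set b := \sum_(0 <= k < K.+1) dispersion _.
lra.
Qed.

Local Notation mode k i := (fun t : nat => modal P (x t%:Z) k i).
Local Notation gmode k i := (fun t : nat => modal P (gradients t) k i).

Lemma modal_sum_drift K s :
  \sum_(i | i != 0) \sum_k \sum_(0 <= j < K.+1) drift tau alpha (gmode k i) j s ^+ 2
  = alpha ^+ 2 * \sum_(0 <= j < K.+1)
      dispersion (fun l => gradients (j * tau + s)%N l - gradients (j * tau)%N l).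
Proof.
under eq_bigr => i _ do rewrite exchange_big.
rewrite exchange_big mulr_sumr; apply: eq_bigr => j _ /=.
rewrite -(modal_dispersion PP P0) mulr_sumr; apply: eq_bigr => i _.
by rewrite mulr_sumr; apply: eq_bigr => k _; rewrite /drift exprMn modalB.
Qed.

(** Sum of mode_energy over all coordinates and all modes but the mean. The
    drifts on its right-hand side are bounded through sum_grad_drift by the
    consensus energy E itself, with the small factor alpha^2 L^2 C, and by the
    mean gradients. *)
Lemma consensus_energy (A rb : R) K :
  0 < A -> 0 <= rb < 1 ->
  (forall i : 'I_N.+1, i != 0 -> let r := 1 - xi + xi * lam`_i in
    [/\ 0 < r < 1, 0 < mode_disc tau%:R r, 4 * tau%:R ^+ 2 <= A * mode_disc tau%:R r
      & r <= rb ^+ 2]) ->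
  forall E Z C : R,
  E = \sum_(1 <= t < (K.+1 * tau).+1) dispersion (x t%:Z) ->
  Z = 4 * (dispersion (x 0) + E)
     + alpha ^+ 2 * tau%:R * \sum_(0 <= t < K.+1 * tau) mean_grad t ->
  C = tau%:R ^+ 2 * A / (1 - rb) ^+ 2
       * (tau%:R * (rb ^+ 2) ^+ 3 + (tau%:R - 1) / 4) + tau%:R ^+ 2 * (tau%:R - 1) ->
  E <= 6 * tau%:R ^+ 2 * A / (1 - rb) * (dispersion (x 0) + dispersion (x 1))
   + alpha ^+ 2 * L ^+ 2 * C * Z.
Proof.
move=> A0 /andP[rb0 rb1] hmode E Z C EE ZE CE.
pose S (F : 'I_N.+1 -> 'I_n -> R) := \sum_(i | i != 0) \sum_k F i k.
have SD F G : S (fun i k => F i k + G i k) = S F + S G.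
  by rewrite /S -big_split; apply: eq_bigr => i _; rewrite -big_split.
have SM c F : S (fun i k => c * F i k) = c * S F.
  by rewrite /S mulr_sumr; apply: eq_bigr => i _; rewrite mulr_sumr.
pose H i k := \sum_(0 <= j < K.+1) drift tau alpha (gmode k i) j tau ^+ 2.
pose Y i k := \sum_(0 <= j < K.+1) local_drift tau alpha (gmode k i) j.
have ES : E = S (fun i k => \sum_(0 <= j < K.+1) \sum_(1 <= s < tau.+1)
    mode k i (j * tau + s)%N ^+ 2).
  rewrite EE sum_by_periods /S.
  under [RHS]eq_bigr => i _ do rewrite exchange_big.
  rewrite [RHS]exchange_big; apply: eq_bigr => j _ /=.
  under [RHS]eq_bigr => i _ do rewrite exchange_big.
  rewrite [RHS]exchange_big; apply: eq_bigr => s _ /=.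
  by rewrite -(modal_dispersion PP P0).
have tau1' : 1 <= tau%:R :> R by rewrite ler1n.
have D_le s : (1 <= s <= tau)%N ->
    S (fun i k => \sum_(0 <= j < K.+1) drift tau alpha (gmode k i) j s ^+ 2)
      <= alpha ^+ 2 * L ^+ 2 * Z.
  move=> hs; rewrite /S modal_sum_drift -mulrA ler_wpM2l ?sqr_ge0 //.
  by rewrite ZE EE; apply: sum_grad_drift.
have SH : S H <= alpha ^+ 2 * L ^+ 2 * Z by apply: D_le; rewrite tau1 leqnn.
have SY : S Y <= (tau%:R - 1) * (alpha ^+ 2 * L ^+ 2 * Z).
  have -> : S Y = \sum_(1 <= s < tau)
    S (fun i k => \sum_(0 <= j < K.+1) drift tau alpha (gmode k i) j s ^+ 2).
    rewrite /S /Y /local_drift [RHS]exchange_big; apply: eq_bigr => i _ /=.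
    by rewrite [RHS]exchange_big; apply: eq_bigr => k _ /=; rewrite exchange_big.
  rewrite big_nat; apply: le_trans (ler_sum _ (_ : forall s, _ -> _ <= alpha ^+ 2 * L ^+ 2 * Z)) _.
    by move=> s /andP[s1 sT]; apply: D_le; rewrite s1 ltnW.
  by rewrite -big_nat sumr_const_nat -[_ *+ _]mulr_natl natrB.
pose a i k := modal P (x 0) k i ^+ 2 + modal P (x 1) k i ^+ 2.
have Sa : S a = dispersion (x 0) + dispersion (x 1).
  by rewrite (SD (fun i k => modal P (x 0) k i ^+ 2)) -!(modal_dispersion PP P0).
set c1 := 6 * tau%:R ^+ 2 * A / (1 - rb); set c4 : R := tau%:R ^+ 2.
pose c2 := tau%:R ^+ 2 * A / (1 - rb) ^+ 2; pose c3 := tau%:R * (rb ^+ 2) ^+ 3.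
have S_le : E <= c1 * S a + c2 * (c3 * S H + 4^-1 * S Y) + c4 * S Y.
  rewrite ES -(SM c1) -(SM c3) -(SM 4^-1) -SD -(SM c2) -SD -(SM c4) -SD.
  apply: ler_sum => i i0; apply: ler_sum => k _.
  have [r01 disc0 hA rrb] := hmode i i0.
  have [r0 r1] := andP r01.
  have sr0 : 0 < Num.sqrt (1 - xi + xi * lam`_i) by rewrite sqrtr_gt0.
  have sr1 : Num.sqrt (1 - xi + xi * lam`_i) <= rb.
    by apply: (le_trans (ler_wsqrtr rrb)); rewrite sqrtr_sqr ger0_norm.
  have sr : 0 < Num.sqrt (1 - xi + xi * lam`_i) <= rb by rewrite sr0.
  have := @mode_energy _ tau _ alpha _ _ tau1 (MILE_modal k i run symW PW)
    r01 disc0 A rb _ K hA (sqr_sqrtr (ltW r0)) sr rb1.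
  by rewrite -/(H i k) -mulr_suml -/(Y i k) [Y i k / 4]mulrC.
have c1_ge0 : 0 <= c2.
  by rewrite /c2 divr_ge0 ?sqr_ge0 // mulr_ge0 ?sqr_ge0 // ltW.
have c3_ge0 : 0 <= c3 by rewrite /c3 mulr_ge0 // exprn_ge0 // sqr_ge0.
have c4_ge0 : 0 <= c4 by apply: sqr_ge0.
rewrite Sa in S_le; apply: (le_trans S_le); rewrite -addrA lerD2l CE.
rewrite -/c2 -/c3 -/c4.
set pZ := alpha ^+ 2 * L ^+ 2 * Z in SH SY.
have := ler_wpM2l c4_ge0 SY.
have := ler_wpM2l c1_ge0 (lerD (ler_wpM2l c3_ge0 SH) (ler_wpM2l (_ : 0 <= 4^-1) SY)).
rewrite invr_ge0 ler0n => /(_ isT) h1 h2.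
apply: (le_trans (lerD h1 h2)).
rewrite le_eqVlt; apply/orP; left; apply/eqP; rewrite /pZ; ring.
Qed.
End Run.

(** * The constants and the rate *)

Lemma A1_bound (R : realType) N tau (xi : R) lam i :
  (2 <= i < N.+1)%N -> 0 < mode_disc tau%:R (rho_ xi lam i) ->
  4 * tau%:R ^+ 2 <= A1 N tau xi lam ^+ 2 * mode_disc tau%:R (rho_ xi lam i).
Proof.
move=> iN D0.
have sD0 : 0 < Num.sqrt (mode_disc tau%:R (rho_ xi lam i)) by rewrite sqrtr_gt0.
have term_le : 2 * tau%:R / Num.sqrt (mode_disc tau%:R (rho_ xi lam i)) <= A1 N tau xi lam.
  by rewrite /A1; apply: (le_bigmax_seq 0 i) => //; rewrite mem_index_iota.
have -> : 4 * tau%:R ^+ 2 = (2 * tau%:R) ^+ 2 :> R by ring.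
rewrite -[X in _ <= _ * X](sqr_sqrtr (ltW D0)) -exprMn.
rewrite lerXn2r ?nnegrE ?mulr_ge0 ?(ltW sD0) //.
  by apply: le_trans term_le; rewrite divr_ge0 ?(ltW sD0) // mulr_ge0.
by rewrite -ler_pdivrMr.
Qed.

Lemma A1_gt0 (R : realType) N tau (xi : R) lam :
  (2 <= N)%N -> (1 <= tau)%N -> 0 < mode_disc tau%:R (rho xi lam) ->
  0 < A1 N tau xi lam.
Proof.
move=> N2 tau1 D0; have N2' : (2 <= 2 < N.+1)%N by rewrite ltnS.
have h := A1_bound N2' D0.
have A0 : 0 <= A1 N tau xi lam by apply: bigmax_ge_id.
rewrite lt_neqAle A0 eq_sym andbT; apply: contraTneq h => ->.
by rewrite expr0n mul0r -ltNge mulr_gt0 // exprn_gt0 // ltr0n.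
Qed.

(** A1 is one of the two terms of the maximum A4. *)
Lemma B2_lower (R : realType) N tau (xi : R) lam :
  0 < rho xi lam < 1 -> 0 <= A1 N tau xi lam ->
  3 * tau%:R ^+ 4 + tau%:R ^+ 2 * (tau%:R + 1) * (2 * tau%:R + 1)
    * (rho xi lam * tau%:R + tau%:R - 1) ^+ 2 / 2
    * (A1 N tau xi lam ^+ 2 / (1 - Num.sqrt (rho xi lam)) ^+ 2)
  <= B2 N tau xi lam.
Proof.
move=> /andP[r0 r1] A0.
have sr1 : Num.sqrt (rho xi lam) < 1 by rewrite -sqrtr1 ltr_sqrt.
have A14 : A1 N tau xi lam <= A4 N tau xi lam by rewrite /A4 le_max lexx.
rewrite /B2 lerD2l.
set a1 := A1 N tau xi lam in A0 A14 *; set a4 := A4 N tau xi lam in A14 *.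
set s := 1 - Num.sqrt (rho xi lam).
have s0 : 0 < s by rewrite subr_gt0.
set X := _ * (rho xi lam * _ + _ - 1) ^+ 2.
have -> : X / (2 * s ^+ 2) * a4 ^+ 2 = X / 2 * (a4 ^+ 2 / s ^+ 2).
  by field; rewrite gt_eqF.
have t0 : 0 <= tau%:R :> R by [].
apply: ler_wpM2l.
  apply: divr_ge0 => //; apply: mulr_ge0 (sqr_ge0 _); apply: mulr_ge0; last lra.
  by apply: mulr_ge0 (sqr_ge0 _) _; lra.
by rewrite ler_wpM2r ?invr_ge0 ?sqr_ge0 // lerXn2r ?nnegrE // (le_trans A0).
Qed.

(** The self-bounding estimate is solved for E. Here r is rho, s is
    1 - sqrt rho, p is (alpha L)^2, aS is alpha^2 times the sum of the mean
    gradients, and B is B2. The step-size condition p * (5 * B) <= 1 gives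
    p * C <= 1 / 15, so that 4 / 15 of E is absorbed on the left. The initial
    term is controlled through g = p t^2 A / s, where the factor
    (r t + t - 1)^2 of B matters: it is r^2 for t = 1 and at least 1 for t >= 2,
    which accounts for the two initial terms of the rate. *)
Lemma consensus_arith (R : realFieldType) (t r s A B p C Z E e0 e1 f0 f1 aS : R) :
  t = 1 \/ 2 <= t -> 0 < r < 1 -> 0 < s <= 1 -> 0 <= A ->
  3 * t ^+ 4 + t ^+ 2 * (t + 1) * (2 * t + 1) * (r * t + t - 1) ^+ 2 / 2
    * (A / s ^+ 2) <= B ->
  0 <= p -> p * (5 * B) <= 1 ->
  C = t ^+ 2 * A / s ^+ 2 * (t * r ^+ 3 + (t - 1) / 4) + t ^+ 2 * (t - 1) ->
  Z = 4 * (e0 + E) + t * aS ->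
  E <= 6 * t ^+ 2 * A / s * (e0 + e1) + p * C * Z ->
  0 <= aS -> 0 <= E -> 0 <= e0 <= f0 -> 0 <= e1 <= f1 ->
  p * E <= aS / (15 * t ^+ 2) + (f0 + f1) * (4 / t ^+ 2 + 2 / (r ^+ 2 * t ^+ 3)) * 2.
Proof.
move=> t12 /andP[r0 r1] /andP[s0 s1] A0 hB p0 pB CE ZE hE aS0 E0 /andP[e00 ef0] /andP[e10 ef1].
have t1 : 1 <= t by case: t12 => [->|]; lra.
have t0 : 0 < t by lra.
set q := A / s ^+ 2 in hB.
have q0 : 0 <= q by rewrite /q divr_ge0 // sqr_ge0.
pose m := r * t + t - 1.
have m2_ge : t * r ^+ 3 + (t - 1) / 4 <= m ^+ 2.
  have r3 : t * r ^+ 3 <= (r * t) ^+ 2.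
    have h : 0 <= t * r ^+ 2 by rewrite mulr_ge0 ?sqr_ge0 ?ltW.
    have := ler_wpM2l h (_ : r <= t); rewrite (le_trans (ltW r1)) // => /(_ isT).
    lra.
  have h : 0 <= r * t * (t - 1) by apply: mulr_ge0; [apply: mulr_ge0|]; lra.
  have h' : (t - 1) / 4 <= (t - 1) ^+ 2 by case: t12 => [->|t2]; nra.
  rewrite /m; lra.
have poly6 : 6 <= (t + 1) * (2 * t + 1) by nra.
have t2q : 0 <= t ^+ 2 * q by rewrite mulr_ge0 ?sqr_ge0.
set M := (t + 1) * (2 * t + 1) * m ^+ 2.
have M0 : 0 <= M by apply: mulr_ge0 (sqr_ge0 _); lra.
have {}hB : 3 * t ^+ 4 + t ^+ 2 * q * M / 2 <= B.
  by apply: le_trans hB; rewrite le_eqVlt; apply/orP; left; apply/eqP; rewrite /M /m; ring.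
have CB : 3 * C <= B.
  have h1 := ler_wpM2l t2q m2_ge.
  have h2 := ler_wpM2r (mulr_ge0 t2q (sqr_ge0 m)) poly6.
  have h3 : t ^+ 2 * (t - 1) <= t ^+ 4.
    have h4 : t - 1 <= t ^+ 2 by nra.
    by have := ler_wpM2l (sqr_ge0 t) h4; lra.
  have -> : C = t ^+ 2 * q * (t * r ^+ 3 + (t - 1) / 4) + t ^+ 2 * (t - 1).
    by rewrite CE /q; ring.
  by apply: le_trans hB; rewrite /M; lra.
have pC : p * C <= 1 / 15 by have := ler_wpM2l p0 CB; lra.
have t4 : 0 <= t ^+ 4 by rewrite exprn_ge0 // ltW.
have pt4 : p * (15 * t ^+ 4) <= 1.
  have h : 3 * t ^+ 4 <= B by have := mulr_ge0 t2q M0; lra.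
  by have := ler_wpM2l p0 h; lra.
pose g := p * t ^+ 2 * A / s.
have gE : g = s * (p * (t ^+ 2 * q)) by rewrite /g /q; field; rewrite gt_eqF.
have g0 : 0 <= g by rewrite gE; apply: mulr_ge0 (ltW s0) (mulr_ge0 p0 t2q).
have g_le : g * M <= 2 / 5.
  have h1 : t ^+ 2 * q * M / 2 <= B by lra.
  have h2 := ler_wpM2l p0 h1.
  have h3 : 0 <= p * (t ^+ 2 * q) * M by apply: mulr_ge0 (mulr_ge0 p0 t2q) M0.
  have := ler_piMl h3 s1; rewrite gE; lra.
have Z0 : 0 <= Z by rewrite ZE addr_ge0 // mulr_ge0 //; lra.
have E_le : 11 * E <= 90 * t ^+ 2 * A / s * (e0 + e1) + 4 * e0 + t * aS.
  have := ler_wpM2r Z0 pC; rewrite ZE in hE *; lra.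
have pE_le : 11 * (p * E) <= (90 * g + 4 * p) * (f0 + f1) + p * t * aS.
  have h1 := ler_wpM2l p0 E_le.
  have h2 : g * (e0 + e1) <= g * (f0 + f1) by rewrite ler_wpM2l // lerD.
  have h3 : p * e0 <= p * (f0 + f1) by rewrite ler_wpM2l //; lra.
  have h4 : p * (90 * t ^+ 2 * A / s * (e0 + e1)) = 90 * (g * (e0 + e1)).
    by rewrite /g; ring.
  lra.
have gp_le : 90 * g + 4 * p <= 22 * (4 / t ^+ 2 + 2 / (r ^+ 2 * t ^+ 3)).
  case: t12 => [tE|t2].
    have r2 : 0 < r ^+ 2 by rewrite exprn_gt0.
    have gr : g * (6 * r ^+ 2) <= 2 / 5 by move: g_le; rewrite /M /m tE; lra.
    have {}gr : g * 6 <= 2 / 5 / r ^+ 2 by rewrite ler_pdivlMr // -mulrA.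
    have -> : 22 * (4 / t ^+ 2 + 2 / (r ^+ 2 * t ^+ 3)) = 88 + 110 * (2 / 5 / r ^+ 2).
      by rewrite tE; field; rewrite gt_eqF.
    have i0 : 0 <= 2 / 5 / r ^+ 2 by rewrite divr_ge0 // ltW.
    rewrite tE in pt4; lra.
  have m1 : 1 <= m ^+ 2.
    have h : 1 <= m by rewrite /m; have := mulr_gt0 r0 t0; lra.
    by rewrite -[1](expr1n _ 2) lerXn2r ?nnegrE // (le_trans _ h).
  have tt : 0 < t ^+ 2 by rewrite exprn_gt0.
  have gt2 : g * t ^+ 2 <= 1 / 5.
    have h1 : t ^+ 2 * 2 <= M.
      have := ler_wpM2l (_ : 0 <= (t + 1) * (2 * t + 1)) m1.
      by rewrite /M => /(_ ltac:(nra)); nra.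
    have := ler_wpM2l g0 h1; lra.
  have pt2 : p * t ^+ 2 <= 1.
    have h1 : t ^+ 2 <= 15 * t ^+ 4.
      have t21 : 1 <= t ^+ 2 by rewrite exprn_ege1.
      have := ler_wpM2l (sqr_ge0 t) t21; lra.
    by have := ler_wpM2l p0 h1; lra.
  have h : 0 <= 22 * (2 / (r ^+ 2 * t ^+ 3)).
    by rewrite mulr_ge0 // divr_ge0 // mulr_ge0 ?sqr_ge0 // exprn_ge0 // ltW.
  suff : 90 * g + 4 * p <= 22 * (4 / t ^+ 2) by lra.
  rewrite mulrA ler_pdivlMr //; lra.
have pt_le : p * t <= 11 / (15 * t ^+ 2).
  rewrite ler_pdivlMr ?mulr_gt0 ?exprn_gt0 //.
  have h : t ^+ 3 <= t ^+ 4 by rewrite [leRHS]exprS ler_peMl // exprn_ge0 // ltW.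
  have := ler_wpM2l p0 h; lra.
have := ler_wpM2r aS0 pt_le.
have := ler_wpM2r (_ : 0 <= f0 + f1) gp_le.
move=> /(_ ltac:(lra)).
lra.
Qed.

(** mode_disc factors as (1 - r) (r (t + 1)^2 - (t - 1)^2). The bounds on xi and
    l give r > (t - 1) / (t + 3), and (t - 1) / (t + 3) is at least
    ((t - 1) / (t + 1))^2. *)
Lemma mode_disc_gt0 (R : realFieldType) (t xi l : R) :
  1 <= t -> 0 < xi < 2 / (t + 3) -> -1 < l < 1 ->
  let r := 1 - xi + xi * l in 0 < r < 1 /\ 0 < mode_disc t r.
Proof.
move=> t1 /andP[xi0 xi1] /andP[l1 l2] r.
have t3 : 0 < t + 3 by lra.
rewrite ltr_pdivlMr // in xi1.
have r1 : r < 1.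
  by rewrite /r; have := mulr_gt0 xi0 (_ : 0 < 1 - l); rewrite subr_gt0 => /(_ l2); lra.
have r2 : t - 1 < r * (t + 3).
  rewrite /r; have := mulr_gt0 xi0 (_ : 0 < l + 1).
  rewrite -ltrBlDr sub0r => /(_ l1) h.
  have := mulr_gt0 h t3; lra.
have r0 : 0 < r by rewrite -(pmulr_lgt0 _ t3); lra.
rewrite r0 r1; split=> //.
have -> : mode_disc t r = (1 - r) * (r * (t + 1) ^+ 2 - (t - 1) ^+ 2).
  by rewrite /mode_disc; ring.
apply: mulr_gt0; first by lra.
rewrite -(pmulr_lgt0 _ t3).
have : 0 < (r * (t + 3) - (t - 1)) * (t + 1) ^+ 2 by rewrite mulr_gt0 ?exprn_gt0 //; lra.
nra.
Qed.

(** The summed descent inequality, in which G is the sum of the squared gradient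
    norms and S1 that of the mean gradients. As al * L <= 1 / 2, the negative
    S1 term absorbs the share of S1 in the consensus error; the bound X is then
    divided by t (K + 1), and K + 1 >= K. *)
Lemma rate_arith (R : realFieldType) (al L N t K G F S S1 E g0 f0 f1 r : R) :
  0 < al -> al * L <= 1 / 2 -> 2 <= N -> 1 <= t -> 1 <= K -> 0 < r ->
  0 <= F -> 0 <= S1 -> 0 <= g0 -> 0 <= f0 -> 0 <= f1 ->
  al * G <= 2 * F - al * (1 - al * L) * S1 + al * L ^+ 2 / N * E ->
  S <= N * (g0 + S1) ->
  al ^+ 2 * L ^+ 2 * E <= al ^+ 2 * S / (15 * t ^+ 2)
     + (f0 + f1) * (4 / t ^+ 2 + 2 / (r ^+ 2 * t ^+ 3)) * 2 ->
  1 / (t * (K + 1)) * G <= 2 / (t * al * K) * F + g0 / (t ^+ 3 * K)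
    + (4 * f0 + 4 * f1) / (t ^+ 3 * al ^+ 2 * K)
    + (2 * f0 + 2 * f1) / (al ^+ 2 * r ^+ 2 * t ^+ 4 * K).
Proof.
move=> al0 alL N2 t1 K1 r0 F0 S10 g00 f00 f10 hG hS hE.
have t0 : 0 < t by lra.
have K0 : 0 < K by lra.
have N0 : 0 < N by lra.
have tt : 0 < t ^+ 2 by rewrite exprn_gt0.
have aa : 0 < al ^+ 2 by rewrite exprn_gt0.
pose c := 4 / t ^+ 2 + 2 / (r ^+ 2 * t ^+ 3).
have c0 : 0 <= c.
  by rewrite addr_ge0 // divr_ge0 // ?mulr_ge0 ?exprn_ge0 // ltW.
pose X := 2 * F / al + g0 / t ^+ 2 + (f0 + f1) * c / al ^+ 2.
have X0 : 0 <= X.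
  apply: addr_ge0; [apply: addr_ge0|]; apply: divr_ge0; try exact: ltW; try lra.
  by apply: mulr_ge0 c0; lra.
have E_le : L ^+ 2 * E / N <= (g0 + S1) / (15 * t ^+ 2) + (f0 + f1) * c / al ^+ 2.
  have h1 : al ^+ 2 * S / (15 * t ^+ 2) <= al ^+ 2 * (N * (g0 + S1)) / (15 * t ^+ 2).
    by rewrite ler_wpM2r ?invr_ge0 ?ler_wpM2l ?(ltW aa) // mulr_ge0 // ltW.
  have h2 : (f0 + f1) * c * 2 <= (f0 + f1) * c * N.
    by apply: ler_wpM2l N2; apply: mulr_ge0 c0; lra.
  have aN : 0 < al ^+ 2 * N by rewrite mulr_gt0.
  rewrite -(ler_pM2l aN).
  have -> : al ^+ 2 * N * (L ^+ 2 * E / N) = al ^+ 2 * L ^+ 2 * E.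
    by field; rewrite gt_eqF.
  have -> : al ^+ 2 * N * ((g0 + S1) / (15 * t ^+ 2) + (f0 + f1) * c / al ^+ 2)
     = al ^+ 2 * (N * (g0 + S1)) / (15 * t ^+ 2) + (f0 + f1) * c * N.
    by field; rewrite !gt_eqF.
  rewrite -/c in hE; lra.
have G_le : G <= X.
  have it : (15 * t ^+ 2)^-1 <= 1 / 2.
    have h1 : 1 <= t ^+ 2 by rewrite exprn_ege1.
    rewrite -div1r ler_pdivrMr; lra.
  have h1 := ler_wpM2r S10 it.
  have h2 : g0 / (15 * t ^+ 2) <= g0 / t ^+ 2.
    by rewrite ler_wpM2l // lef_pV2 ?posrE //; lra.
  have h3 : 1 / 2 * S1 <= (1 - al * L) * S1 by apply: ler_wpM2r => //; lra.
  rewrite -(ler_pM2l al0).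
  have := ler_wpM2l (ltW al0) E_le; have := ler_wpM2l (ltW al0) h1.
  have := ler_wpM2l (ltW al0) h2; have := ler_wpM2l (ltW al0) h3.
  have -> : al * X = 2 * F + al * (g0 / t ^+ 2) + al * ((f0 + f1) * c / al ^+ 2).
    by rewrite /X; field; rewrite !gt_eqF.
  lra.
have -> : 2 / (t * al * K) * F + g0 / (t ^+ 3 * K)
    + (4 * f0 + 4 * f1) / (t ^+ 3 * al ^+ 2 * K)
    + (2 * f0 + 2 * f1) / (al ^+ 2 * r ^+ 2 * t ^+ 4 * K) = X / (t * K).
  by rewrite /X /c; field; rewrite !gt_eqF.
rewrite div1r mulrC; apply: (@le_trans _ _ (X / (t * (K + 1)))).
  by rewrite ler_wpM2r // invr_ge0 mulr_ge0; lra.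
rewrite ler_wpM2l // lef_pV2 ?posrE ?mulr_gt0 //; last by lra.
by rewrite ler_wpM2l; lra.
Qed.

Theorem theorem1 (R : realType) (N n tau K : nat)
    (hN : (2 <= N)%N) (hn : (1 <= n)%N) (htau : (1 <= tau)%N) (hK : (1 <= K)%N)
    (f : 'I_N -> 'cV[R]_n -> R)
    (hdiff : forall (i : 'I_N) (y : 'cV[R]_n), differentiable (f i) y)
    (L : R) (hL : 0 < L)
    (hLip : forall (i : 'I_N) (y z : 'cV[R]_n),
       fnorm (grad (f i) y - grad (f i) z) <= L * fnorm (y - z))
    (xstar : 'cV[R]_n)
    (hmin : forall y : 'cV[R]_n, favg f xstar <= favg f y)
    (e : rel 'I_N) (he : connected_graph e)
    (W : 'M[R]_N) (hW : mixing_matrix e W)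
    (lam : seq R) (hlam : eigenvalue_list W lam)
    (xi : R) (hxi0 : 0 < xi) (hxi1 : xi < 2 / (tau%:R + 3))
    (alpha : R) (halpha0 : 0 < alpha)
    (halpha1 : alpha <= 1 / (Num.sqrt (5 * B2 N tau xi lam) * L))
    (x : int -> 'I_N -> 'cV[R]_n) (hx : MILE tau xi alpha W f x) :
  let T := (tau + tau * K)%N in
  1 / T%:R
    * \sum_(1 <= t < T.+1) fnorm (grad (favg f) (avg (x t%:Z))) ^+ 2
  <= 2 / (tau%:R * alpha * K%:R) * (favg f (avg (x 1)) - favg f xstar)
     + fnorm (avg (fun i => grad (f i) (x 0 i))) ^+ 2 / (tau%:R ^+ 3 * K%:R)
     + (4 * fnorm (stack (x 0)) ^+ 2 + 4 * fnorm (stack (x 1)) ^+ 2)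
         / (tau%:R ^+ 3 * alpha ^+ 2 * K%:R)
     + (2 * fnorm (stack (x 0)) ^+ 2 + 2 * fnorm (stack (x 1)) ^+ 2)
         / (alpha ^+ 2 * rho xi lam ^+ 2 * tau%:R ^+ 4 * K%:R).
Proof.
case: N hN f hdiff hLip hmin e he W hW hlam halpha1 x hx => [|[|N]] // hN f hdiff
  hLip hmin e he W hW hlam halpha1 x hx /=.
have [[_ symW _ _] [P [PP WE P0 [lam0 lam1] lam_i]]] :=
  (hW, mixing_spectrum hW hlam).
have PW : P *m W = diag_mx (\row_i lam`_i) *m P by rewrite WE !mulmxA PP mul1mx.
have lip i y z : fnorm (grad (f i) y - grad (f i) z) ^+ 2 <= L ^+ 2 * fnorm (y - z) ^+ 2.
  rewrite -exprMn lerXn2r ?nnegrE ?sqrtr_ge0 //.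
  by apply: mulr_ge0 (ltW hL) (sqrtr_ge0 _).
set t : R := tau%:R; set r := rho xi lam.
have t1 : 1 <= t by rewrite ler1n.
have xi01 : 0 < xi < 2 / (t + 3) by rewrite hxi0 hxi1.
have modes (i : 'I_N.+2) : i != 0 -> let q := 1 - xi + xi * lam`_i in
    [/\ 0 < q < 1, 0 < mode_disc t q & q <= r].
  move=> i0 q; have /andP[li1 li2] := lam_i i i0.
  have [] := mode_disc_gt0 t1 xi01 (_ : -1 < lam`_i < 1).
    by rewrite li1 (le_lt_trans li2).
  by split=> //; rewrite lerD2l ler_wpM2l // ltW.
have [r01 D0 _] := modes 1 isT; rewrite [1 - xi + _](_ : _ = r) // in r01 D0.
have [r0 r1] := andP r01.
have A10 : 0 < A1 N.+2 tau xi lam by apply: A1_gt0.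
set A := A1 N.+2 tau xi lam ^+ 2.
have A0 : 0 < A by rewrite exprn_gt0.
have rb2 : Num.sqrt r ^+ 2 = r by rewrite sqr_sqrtr // ltW.
have rb01 : 0 <= Num.sqrt r < 1 by rewrite sqrtr_ge0 -sqrtr1 ltr_sqrt.
have hm (i : 'I_N.+2) : i != 0 -> let q := 1 - xi + xi * lam`_i in
    [/\ 0 < q < 1, 0 < mode_disc t q, 4 * t ^+ 2 <= A * mode_disc t q
      & q <= Num.sqrt r ^+ 2].
  move=> i0 q; have [q01 Dq qr] := modes i i0; split; rewrite ?rb2 //.
  (* the maximum in A1 numbers the eigenvalues from 1 *)
  apply: (A1_bound (i := i.+1)) => //.
  by apply/andP; split; [rewrite ltnS lt0n | exact: ltn_ord i].
pose E := \sum_(1 <= s < (K.+1 * tau).+1) dispersion (x s%:Z).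
pose S := \sum_(0 <= s < K.+1 * tau) mean_grad f x s.
have := consensus_energy htau hx symW PW PP P0 lam0 lip A0 rb01 hm
  (erefl E) (erefl _) (erefl _).
rewrite -/S => E_le.
set b := B2 N.+2 tau xi lam in halpha1.
have b_low := B2_lower r01 (ltW A10); rewrite -/b -/r -/A -/t in b_low.
have q_ge0 : 0 <= A / (1 - Num.sqrt r) ^+ 2 by rewrite divr_ge0 ?sqr_ge0 // ltW.
have b_ge : 3 <= b.
  apply: le_trans b_low; have t4 : 1 <= t ^+ 4 by rewrite exprn_ege1.
  have h : 0 <= t ^+ 2 * (t + 1) * (2 * t + 1) * (r * t + t - 1) ^+ 2 / 2
      * (A / (1 - Num.sqrt r) ^+ 2).
    apply: mulr_ge0 q_ge0; apply: divr_ge0 => //; apply: mulr_ge0 (sqr_ge0 _).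
    by apply: mulr_ge0; [apply: mulr_ge0 (sqr_ge0 _) _|]; lra.
  lra.
have pB : alpha ^+ 2 * L ^+ 2 * (5 * b) <= 1.
  have sb : 0 < Num.sqrt (5 * b) by rewrite sqrtr_gt0; lra.
  have h : alpha * (Num.sqrt (5 * b) * L) <= 1.
    by rewrite -ler_pdivlMr // mulr_gt0.
  have h0 : 0 <= alpha * (Num.sqrt (5 * b) * L).
    by rewrite !mulr_ge0 // ltW.
  have := lerXn2r 2 h0 ler01 h; rewrite expr1n !exprMn sqr_sqrtr; last by lra.
  lra.
have p0 : 0 <= alpha ^+ 2 * L ^+ 2 by rewrite mulr_ge0 ?sqr_ge0.
have aL : alpha * L <= 1 / 2.
  have h : (alpha * L) ^+ 2 <= (1 / 2) ^+ 2.
    rewrite exprMn; have := ler_wpM2l p0 b_ge; lra.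
  by rewrite -(@ler_pXn2r _ 2) ?nnegrE ?mulr_ge0 ?(ltW halpha0) ?(ltW hL) //; lra.
set f0 := fnorm (stack (x 0)) ^+ 2; set f1 := fnorm (stack (x 1)) ^+ 2.
pose g (s : nat) := fnorm (avg (gradients f x s)) ^+ 2.
have g_ge0 s : 0 <= g s by apply: sqr_ge0.
have S_ge0 : 0 <= S by apply: sumr_ge0 => s _; apply: mean_grad_ge0.
have E_ge0 : 0 <= E by apply: sumr_ge0 => s _; apply: dispersion_ge0.
have pE_le : alpha ^+ 2 * L ^+ 2 * E <= alpha ^+ 2 * S / (15 * t ^+ 2)
     + (f0 + f1) * (4 / t ^+ 2 + 2 / (r ^+ 2 * t ^+ 3)) * 2.
  have s01 : 0 < 1 - Num.sqrt r <= 1 by case/andP: rb01 => *; apply/andP; split; lra.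
  have disp0 : 0 <= dispersion (x 0) <= f0 by rewrite dispersion_ge0 dispersion_le.
  have disp1 : 0 <= dispersion (x 1) <= f1 by rewrite dispersion_ge0 dispersion_le.
  rewrite -/t in E_le.
  apply: (consensus_arith _ r01 s01 (ltW A0) b_low p0 pB (erefl _) (erefl _) _ _ E_ge0 disp0 disp1).
  - move: (htau); rewrite leq_eqVlt => /predU1P[tauE|tau2]; first by left; rewrite /t -tauE.
    by right; rewrite ler_nat.
  - by apply: (le_trans E_le); rewrite rb2 le_eqVlt; apply/orP; left; apply/eqP; ring.
  - by rewrite mulr_ge0 ?sqr_ge0.
(* the sum runs over the K + 1 periods 0, ..., K *)
have TE : (tau + tau * K = K.+1 * tau)%N by rewrite mulSn mulnC.
have TR : (tau + tau * K)%:R = t * (K%:R + 1) :> R.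
  by rewrite natrD natrM /t; ring.
set G := \sum_(1 <= s < _) _.
pose F (s : nat) := favg f (avg (x s%:Z)).
pose S1 := \sum_(1 <= s < (K.+1 * tau).+1) g s.
have G_le : alpha * G <= 2 * (favg f (avg (x 1)) - favg f xstar)
    - alpha * (1 - alpha * L) * S1 + alpha * L ^+ 2 / N.+2%:R * E.
  (* the telescoping sum ends above the minimum of favg f *)
  have F_le : F 1%N - F (K.+1 * tau).+1 <= favg f (avg (x 1)) - favg f xstar.
    by rewrite lerD2l lerN2 hmin.
  have FE : F 1%N - F (K.+1 * tau).+1
      = \sum_(1 <= s < (K.+1 * tau).+1) (F s - F s.+1).
    rewrite -[LHS]opprB -telescope_sumr // -sumrN.
    by apply: eq_bigr => s _; rewrite opprB.
  apply: (@le_trans _ _ (2 * (F 1%N - F (K.+1 * tau).+1)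
     - alpha * (1 - alpha * L) * S1 + alpha * L ^+ 2 / N.+2%:R * E)); last by rewrite !lerD2r ler_wpM2l.
  rewrite FE /G TE /S1 /E !mulr_sumr -sumrB -big_split; apply: ler_sum => s _ /=.
  have := gradient_step_descent (ltn0Sn _) hdiff lip (x s%:Z) hL halpha0.
  rewrite /dispersion sqr_fnorm_deviation // /F /g.
  by rewrite (mean_step hx symW PW PP P0 lam0).
have S_le : S <= N.+2%:R * (g 0%N + S1).
  rewrite /S /S1 -(mulr_sumr) ler_wpM2l // -[leLHS]/(\sum_(0 <= s < K.+1 * tau) g s).
  have T0 : (0 < K.+1 * tau)%N by rewrite muln_gt0.
  by rewrite big_ltn // lerD2l [leRHS]big_nat_recr //= lerDl.
rewrite TR.
apply: (rate_arith halpha0 aL _ t1 _ r0 _ _ _ _ _ G_le S_le pE_le) => //.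
- by rewrite ler_nat.
- by rewrite ler1n.
- by rewrite subr_ge0.
- by apply: sumr_ge0.
- exact: sqr_ge0.
- exact: sqr_ge0.
Qed.
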